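(* Let $$u(x):=\inf_{\tau}\ln\mathbb{E}_x\Big[e^{\int_0^\tau g(X_s)ds+G(X_\tau)}\Big],\qquad w(x):=\inf_{\tau}\liminf_{T\to\infty}\ln\mathbb{E}_x\Big[e^{\int_0^{\tau\wedge T}g(X_s)ds+G(X_{\tau\wedge T})}\Big],\quad x\in E.$$ Consider the continuous-time Bellman equation $$e^{v(x)}=\inf_{\tau}\mathbb{E}_x\Big[e^{\int_0^{\tau\wedge t}g(X_s)ds+1_{\{\tau<t\}}G(X_\tau)+1_{\{\tau\ge t\}}v(X_t)}\Big]\quad\text{for all }t\ge0,\ x\in E,$$ for measurable $v:E\to[0,\infty)$. Then: (1) The functions $u$ and $w$ are solutions to the Bellman equation. (2) For any solution $v$ to the Bellman equation satisfying $0\le v(\cdot)\le G(\cdot)$ we have $u(\cdot)\le v(\cdot)\le w(\cdot)$.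
   Context: Setting. $E$ is a locally compact separable metric space; $X=(X_t)_{t\ge0}$ is a time-homogeneous continuous-time standard Markov process with values in $E$ on $(\Omega,\mathcal{F},(\mathcal{F}_t))$ (càdlàg paths, strong Markov, quasi-left continuous, with right-continuous complete filtration); $\mathbb{P}_x$ is its law started from $X_0=x$, with expectation $\mathbb{E}_x$. $X$ is $C_0$-Feller: its transition semigroup maps $\mathcal{C}_0(E)$ (real continuous functions vanishing at infinity) into itself. Standing assumptions. (i) $G:E\to[0,\infty)$ is continuous (possibly unbounded); $g:E\to[0,\infty)$ is continuous and bounded with $g(\cdot)\ge c$ for some $c>0$. (ii) $\mathbb{E}_x[\sup_{t\in[0,T]}e^{G(X_t)}]<\infty$ for all $T\ge0$, $x\in E$. (iii) For every $T\ge0$ and every continuous $h$ with $0\le h(\cdot)\le G(\cdot)$, the map $x\mapsto\mathbb{E}_x[\exp(\int_0^Tg(X_s)ds+h(X_T))]$ is continuous. Infima are over stopping times of $(\mathcal{F}_t)$; on $\{\tau=\infty\}$ the quantity $e^{\int_0^\tau g(X_s)ds+G(X_\tau)}$ equals $+\infty$. *)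

(* Defs.v *)
From HB Require Import structures.
From mathcomp Require Import all_boot all_order all_algebra.
From mathcomp Require Import all_classical all_reals all_analysis.
From mathcomp Require Import measurable_realfun.

Set Implicit Arguments.
Unset Strict Implicit.
Unset Printing Implicit Defensive.

Import Order.TTheory GRing.Theory Num.Theory.
Import numFieldNormedType.Exports.

Local Open Scope classical_set_scope.
Local Open Scope ring_scope.

(* The library only equips pointed types with generated sigma-algebras. *)
#[short(type="pmetricType")]
HB.structure Definition PointedMetric (K : numDomainType) :=
  {M of Pointed M & Metric K M}.

Definition separable (T : topologicalType) :=
  exists2 D : set T, countable D & dense D.

Definition borel (R : realType) (E : pmetricType R) :=
  g_sigma_algebraType (@open E).

(* Time is modelled by R; only the values at t >= 0 of F and X matter. *)
Section markov.
Context {R : realType} {E : pmetricType R} {d : measure_display}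
  {Omega : measurableType d}.
Variables (F : R -> set (set Omega)) (X : R -> Omega -> E)
  (P : E -> probability Omega R).
Local Open Scope ereal_scope.

Definition stopping_time (tau : Omega -> \bar R) :=
  (forall w, 0 <= tau w) /\
  (forall t : R, (0 <= t)%R -> F t [set w | tau w <= t%:E]).

(* the sigma-algebra of events prior to tau *)
Definition stopped_events (tau : Omega -> \bar R) : set (set Omega) :=
  [set A | measurable A /\
    forall t : R, (0 <= t)%R -> F t (A `&` [set w | tau w <= t%:E])].

(* N is null for the law P_mu := \int P_y mu(dy) with initial law mu *)
Definition null_from (mu : probability (borel E) R) (N : set Omega) :=
  exists M : set Omega, [/\ measurable M, N `<=` M &
    {ae mu, forall y, P y M = 0}].

(* No single reference law is available: as usual for Markov processes,
   completeness is with respect to the family of all the laws P_mu. *)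
Definition complete_filtration :=
  forall (t : R) (A : set Omega), (0 <= t)%R ->
    (forall mu : probability (borel E) R, exists2 B, F t B &
      null_from mu ((A `\` B) `|` (B `\` A))) ->
    F t A.

Record usual_filtration : Prop := UsualFiltration {
  filtration_sigma : forall t : R, (0 <= t)%R -> sigma_algebra setT (F t) ;
  filtration_sub : forall t : R, (0 <= t)%R -> F t `<=` measurable ;
  filtration_mono : forall s t : R, (0 <= s <= t)%R -> F s `<=` F t ;
  filtration_right : forall t : R, (0 <= t)%R ->
    \bigcap_(s in [set s | (t < s)%R]) F s `<=` F t ;
  filtration_complete : complete_filtration }.

Definition adapted := forall (t : R) (B : set (borel E)),
  (0 <= t)%R -> measurable B -> F t (X t @^-1` B).

Definition cadlag_paths := forall w : Omega,
  (forall t : R, (0 <= t)%R -> X s w @[s --> t^'+] --> X t w) /\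
  (forall t : R, (0 < t)%R -> exists l : E, X s w @[s --> t^'-] --> l).

(* P_x (X_(tau + s) \in B | F_tau) = P_(X_tau) (X_s \in B), P_x-almost surely
   on {tau < +oo} *)
Definition strong_markov := forall (x : E) (tau : Omega -> \bar R) (s : R)
    (A : set Omega) (B : set (borel E)),
  stopping_time tau -> (0 <= s)%R -> stopped_events tau A -> measurable B ->
  P x (A `&` [set w | tau w < +oo /\ B (X (fine (tau w) + s)%R w)]) =
  \int[P x]_(w in A `&` [set w | tau w < +oo])
    P (X (fine (tau w)) w) (X s @^-1` B).

Definition quasi_left_continuous :=
  forall (x : E) (tau_ : nat -> Omega -> \bar R),
  (forall n, stopping_time (tau_ n)) ->
  (forall w, nondecreasing_seq (tau_ ^~ w)) ->
  {ae P x, forall w, ereal_sup (range (tau_ ^~ w)) < +oo ->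
    X (fine (tau_ n w)) w @[n --> \oo] -->
    X (fine (ereal_sup (range (tau_ ^~ w)))) w}.

Record standard_markov_process : Prop := StandardMarkovProcess {
  markov_filtration : usual_filtration ;
  markov_adapted : adapted ;
  markov_start : forall x : E, P x (X 0%R @^-1` [set x]) = 1 ;
  markov_kernel : forall (t : R) (B : set (borel E)),
    (0 <= t)%R -> measurable B ->
    measurable_fun [set: borel E] (fun x => P x (X t @^-1` B)) ;
  markov_cadlag : cadlag_paths ;
  markov_strong : strong_markov ;
  markov_quasi_left : quasi_left_continuous }.

Definition vanishing_continuous (f : E -> R) :=
  continuous f /\
  forall e : R, (0 < e)%R ->
    exists2 K : set E, compact K & forall x, ~ K x -> (`|f x| < e)%R.

Definition C0_feller := forall (t : R) (f : E -> R), (0 <= t)%R ->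
  vanishing_continuous f ->
  vanishing_continuous (fun x => (\int[P x]_w f (X t w))%R).

End markov.

Section stopping.
Context {R : realType} {E : pmetricType R} {d : measure_display}
  {Omega : measurableType d}.
Variables (F : R -> set (set Omega)) (X : R -> Omega -> E)
  (P : E -> probability Omega R) (G g : E -> R).
Local Open Scope ereal_scope.

Definition running_cost (r : R) (w : Omega) : R :=
  (\int[lebesgue_measure]_(s in `[0%R, r]) g (X s w))%R.

Definition stop_cost (tau : Omega -> \bar R) (w : Omega) : \bar R :=
  if tau w is r%:E then (expR (running_cost r w + G (X r w)))%:E else +oo.

Definition value_u (x : E) : \bar R :=
  ereal_inf [set lne (\int[P x]_w stop_cost tau w) | tau in stopping_time F].

Definition value_w (x : E) : \bar R :=
  ereal_inf
    [set limf_einf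
       (fun T : R => lne (\int[P x]_w stop_cost (fun w => mine (tau w) T%:E) w))
       (+oo)%R
    | tau in stopping_time F].

Definition bellman_cost (v : E -> \bar R) (t : R) (tau : Omega -> \bar R)
    (w : Omega) : \bar R :=
  let r := fine (mine (tau w) t%:E) in
  expeR ((running_cost r w)%:E +
    (if tau w < t%:E then (G (X r w))%:E else v (X t w))).

(* The codomain \bar R together with the bounds 0 <= v < +oo encodes functions
   with values in [0, +oo). *)
Record bellman_solution (v : E -> \bar R) : Prop := BellmanSolution {
  bellman_measurable : measurable_fun [set: borel E] (v : borel E -> \bar R) ;
  bellman_range : forall x, 0 <= v x < +oo ;
  bellman_equation : forall (t : R) (x : E), (0 <= t)%R ->
    expeR (v x) =
    ereal_inf [set \int[P x]_w bellman_cost v t tau w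
              | tau in stopping_time F] }.

End stopping.

(* Main.v *)
From HB Require Import structures.
Require Import Defs.
From mathcomp Require Import all_boot all_order all_algebra.
From mathcomp Require Import all_classical all_reals all_analysis.
From mathcomp Require Import measurable_realfun.
From mathcomp Require Import ring lra.

(** Write Z_t for the exponential of the running cost up to time t. Everything is
stated for exponentials: the logarithms of the problem only return at the end.

Fix a time unit b. For a terminal reward p between 1 and e^G, the problem with
deadline k b charges Z e^G(X) for stopping before the deadline and Z p(X) at the
deadline. If e^v solves the Bellman equation with 0 <= v <= G, then p = e^v gives
back e^v for every k, so e^v lies between the values V_k for p = 1 and W_k for
p = e^G. Here V_k increases and W_k decreases with k, and the theorem amounts to
identifying the limits: lim W_k = e^w and lim V_k = e^u. The Bellman equation
passes to both limits from dynamic programming over one unit of time, and as b is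
arbitrary it holds at every t.

The filtration may be larger than the one generated by the process and Omega
carries no shift operators, so dynamic programming cannot be done by restarting
stopping times. It is done on the grids of mesh b / 2 ^ n by backward induction
with Feynman-Kac operators ([grid_value]), for which the Markov property at fixed
times suffices ([markov_kac]); the value process is a submartingale, and a
martingale until stopping is optimal ([stopped_le], [stopped_ge]). Since paths
are right-continuous and the supremum of e^G(X) on bounded intervals is integrable,
rounding a stopping time up to the grid changes its cost little
([integral_grid_cost_cvg]), and the refined values, the limits of the grid values,
satisfy dynamic programming with all stopping times ([refined_value_le_cost],
[cost_le_cost]).

The identity lim W_k = e^w is then direct ([value_wE]): truncated stopping times
have a deadline, and optimal grid strategies are bounded. So is lim V_k <= e^u. The
substance is e^u <= lim V_k ([stop_cost_upper]): a cheap strategy for each deadline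
must yield one without deadline, although e^G(X) is not controlled at the deadline.
On a grid, stop when the refined value for the remaining time reaches
(1 - eps) e^G(X). These times decrease when the grid is refined and when the
deadline grows ([near_time_decreasing]), so they have a limit, along which the
costs converge by right-continuity. Their costs are nearly optimal: the exactly
optimal time on the grid makes the value process a martingale, and it comes
strictly first only with a probability bounded by the gap between grid value and
refined value divided by eps ([late_probability]). Refining the grid fast enough
as the deadline grows, Borel-Cantelli and Fatou bound the cost of the limit time
by (lim V_k + eps) / (1 - eps). *)

Set Implicit Arguments.
Unset Strict Implicit.
Unset Printing Implicit Defensive.

Import Order.TTheory GRing.Theory Num.Theory.
Import numFieldNormedType.Exports.

Local Open Scope classical_set_scope.
Local Open Scope ring_scope.
Local Open Scope ereal_scope.

(** * Measure-theoretic tools *)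

Section simple_function_induction.
Import HBNNSimple.
Context {R : realType} {d : measure_display} {T : measurableType d}.

(** Nonnegative measurable functions are increasing limits of nonnegative
combinations of indicators; this turns an identity on events into one on
functions. *)
Lemma ge0_measurable_ind (H : (T -> \bar R) -> Prop) :
  (forall A, measurable A -> H (fun x => (\1_A x)%:E)) ->
  (forall f g, measurable_fun setT f -> measurable_fun setT g ->
    (forall x, 0 <= f x) -> (forall x, 0 <= g x) -> H f -> H g ->
    H (fun x => f x + g x)) ->
  (forall (c : R) f, (0 <= c)%R -> measurable_fun setT f ->
    (forall x, 0 <= f x) -> H f -> H (fun x => c%:E * f x)) ->
  (forall (f_ : nat -> T -> \bar R) f, (forall n, measurable_fun setT (f_ n)) ->
    (forall n x, 0 <= f_ n x) -> (forall x, nondecreasing_seq (f_ ^~ x)) ->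
    (forall x, f_ ^~ x @ \oo --> f x) -> (forall n, H (f_ n)) -> H f) ->
  forall f, measurable_fun setT f -> (forall x, 0 <= f x) -> H f.
Proof.
move=> H1 HD HZ Hlim f mf f0.
pose f_ := nnsfun_approx measurableT mf.
apply: (Hlim (fun n x => (f_ n x)%:E) f) => //.
- by move=> n; apply/measurable_EFinP.
- by move=> n x; rewrite lee_fin.
- by move=> x m n mn; rewrite lee_fin; have /lefP := nd_nnsfun_approx measurableT mf mn; exact.
- by move=> x; apply: (cvg_nnsfun_approx measurableT mf (fun x _ => f0 x)).
move=> n; move: (f_ n) => h.
have [s [s0 ->]] : exists s : seq R, (forall r, r \in s -> (0 <= r)%R) /\
    (fun x => (h x)%:E) =
    (fun x => \sum_(r <- s) (r * \1_(h @^-1` [set r]) x)%:E).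
  exists (finmap.enum_fset (fset_set (range h))); split.
    by move=> r; rewrite in_fset_set// => /set_mem[x _ <-]; exact: fun_ge0.
  by apply/funext => x; rewrite (fimfunE h) fsbig_finite// sumEFin.
elim: s s0  => [_|r l IH sr].
  rewrite (_ : (fun _ => _) = fun x => 0%:E * (\1_(setT) x)%:E).
    by apply: HZ => //; [apply/measurable_EFinP|exact: (H1 _ measurableT)].
  by apply/funext => x; rewrite big_nil mul0e.
have r0 : (0 <= r)%R by apply: sr; rewrite inE eqxx.
have l0 q : q \in l -> (0 <= q)%R by move=> ql; apply: sr; rewrite inE ql orbT.
have mI q : measurable (h @^-1` [set q]) by [].
have mI' (q : R) : measurable_fun setT (fun x => (\1_(h @^-1` [set q]) x)%:E : \bar R).
  exact/measurable_EFinP.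
rewrite (_ : (fun _ => _) = fun x => r%:E * (\1_(h @^-1` [set r]) x)%:E +
   \sum_(r <- l) (r * \1_(h @^-1` [set r]) x)%:E); last first.
  by apply/funext => x; rewrite big_cons EFinM.
apply: HD.
- exact: measurable_funeM.
- by apply: emeasurable_sum => q; apply/measurable_EFinP/measurable_funM.
- by move=> x; rewrite -EFinM lee_fin mulr_ge0.
- move=> x; rewrite big_seq sume_ge0// => q ql.
  by rewrite lee_fin mulr_ge0// l0.
- by apply: HZ => //; apply: H1.
- exact: IH.
Qed.

End simple_function_induction.

Section measure_tools.
Context {R : realType} {d : measure_display} {T : measurableType d}.

(** The integral of a nonnegative function is the supremum of the integrals of
the simple functions below it. *)
Lemma ge0_le_integralT (mu : {measure set T -> \bar R}) (f g : T -> \bar R) :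
  (forall x, 0 <= f x) -> (forall x, f x <= g x) ->
  \int[mu]_x f x <= \int[mu]_x g x.
Proof.
move=> f0 fg; have g0 x : 0 <= g x by apply: le_trans (fg x).
rewrite !ge0_integralTE//; apply: ereal_sup_le => _ [h hf <-].
by exists h => // x; apply: le_trans (fg x).
Qed.

Lemma ge0_dominated_cvge (mu : {measure set T -> \bar R}) (A : set T)
    (f_ : nat -> T -> \bar R) (f h : T -> \bar R) :
  measurable A -> (forall n, measurable_fun setT (f_ n)) ->
  (forall w, A w -> f_ ^~ w @ \oo --> f w) ->
  measurable_fun setT f ->
  (forall n w, 0 <= f_ n w) -> (forall n w, f_ n w <= h w) ->
  measurable_fun setT h -> \int[mu]_w h w < +oo ->
  \int[mu]_(w in A) f_ n w @[n --> \oo] --> \int[mu]_(w in A) f w.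
Proof.
move=> mA mf_ f_f mf f0 fh mh hoo.
have h0 w : 0 <= h w by apply: le_trans (fh 0%N w).
have ih : mu.-integrable A h.
  apply: (integrableS measurableT) => //.
  apply/integrableP; split => //.
  by under eq_integral do rewrite gee0_abs//.
have cvf : {ae mu, forall w, A w -> f_ ^~ w @ \oo --> f w} by exact: aeW.
have bdf : {ae mu, forall w n, A w -> `|f_ n w| <= h w}.
  by apply: aeW => w n Aw; rewrite gee0_abs.
by have [_ _ +] := dominated_convergence mA
  (fun n => measurable_funTS (mf_ n)) (measurable_funTS mf) cvf ih bdf.
Qed.

Lemma ge0_dominated_cvg (mu : {measure set T -> \bar R}) (A : set T)
    (f_ : nat -> T -> R) (f : T -> R) (h : T -> \bar R) :
  measurable A -> (forall n, measurable_fun setT (f_ n)) ->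
  (forall w, A w -> f_ ^~ w @ \oo --> f w) ->
  measurable_fun setT f ->
  (forall n w, (0 <= f_ n w)%R) -> (forall n w, (f_ n w)%:E <= h w) ->
  measurable_fun setT h -> \int[mu]_w h w < +oo ->
  \int[mu]_(w in A) (f_ n w)%:E @[n --> \oo] --> \int[mu]_(w in A) (f w)%:E.
Proof.
move=> mA mf_ f_f mf f0 fh mh hoo.
apply: (@ge0_dominated_cvge mu A (fun n w => (f_ n w)%:E) (fun w => (f w)%:E) h) => //.
- by move=> n; apply/measurable_EFinP.
- by move=> w Aw; apply/cvg_EFin; [apply: nearW|exact: f_f].
- exact/measurable_EFinP.
Qed.

Lemma measurable_select d' (T' : measurableType d') (f : nat -> T -> T')
    (N : T -> nat) : (forall j, measurable_fun setT (f j)) ->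
  (forall j, measurable [set w | N w = j]) ->
  measurable_fun setT (fun w => f (N w) w).
Proof.
move=> mf mN _ B mB; rewrite setTI.
rewrite (_ : _ @^-1` _ = \bigcup_j ([set w | N w = j] `&` (f j @^-1` B))).
  apply: bigcupT_measurable => j; apply: measurableI => //.
  by rewrite -[X in measurable X]setTI; exact: mf.
apply/seteqP; split => [w /= ?|w /= [j _ [/= <-]]] //; by exists (N w).
Qed.

(** Monotone class argument on the weight [Y], indicators being the hypothesis
on the events of [F]. *)
Lemma integral_weight (mu : {measure set T -> \bar R}) (F : set (set T))
    (f1 f2 Y : T -> \bar R) : sigma_algebra setT F -> F `<=` measurable ->
  measurable_fun setT f1 -> measurable_fun setT f2 ->
  (forall w, 0 <= f1 w) -> (forall w, 0 <= f2 w) ->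
  (forall A, F A -> \int[mu]_(w in A) f1 w = \int[mu]_(w in A) f2 w) ->
  (forall w, 0 <= Y w) ->
  measurable_fun [set: g_sigma_algebraType F] (Y : g_sigma_algebraType F -> \bar R) ->
  \int[mu]_w (Y w * f1 w) = \int[mu]_w (Y w * f2 w).
Proof.
move=> sF Fm mf1 mf2 f10 f20 f12 Y0 mY.
have FE : <<s F >> = F by exact: sigma_algebra_id.
have mT (Z : g_sigma_algebraType F -> \bar R) : measurable_fun setT Z ->
    measurable_fun [set: T] (Z : T -> \bar R).
  move=> mZ _ B mB; apply: Fm; rewrite -FE; exact: mZ.
pose H (Z : g_sigma_algebraType F -> \bar R) :=
  \int[mu]_w (Z w * f1 w) = \int[mu]_w (Z w * f2 w).
suff : H Y by [].
apply: (@ge0_measurable_ind _ _ _ H) => // {mY Y0 Y}.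
- move=> A; rewrite [measurable A](_ : _ = <<s F >> A)// FE => FA; rewrite /H.
  have e f : \int[mu]_w ((\1_A w)%:E * f w) = \int[mu]_(w in A) f w.
    rewrite [RHS]integral_mkcond epatch_indic; apply: eq_integral => w _ /=.
    by rewrite muleC.
  by rewrite !e f12.
- move=> f g /mT mf /mT mg f0 g0; rewrite /H => hf hg.
  under eq_integral do rewrite ge0_muleDl//.
  under [RHS]eq_integral do rewrite ge0_muleDl//.
  rewrite !ge0_integralD// ?hf ?hg//; try (by move=> *; rewrite mule_ge0);
  exact: emeasurable_funM.
- move=> c f c0 /mT mf f0; rewrite /H => hf.
  under eq_integral do rewrite -muleA.
  under [RHS]eq_integral do rewrite -muleA.
  rewrite !ge0_integralZl ?hf//; try (by move=> *; rewrite mule_ge0);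
  exact: emeasurable_funM.
- move=> f_ f mf_ f_0 f_nd f_f; rewrite /H => hf.
  have cv (h : T -> \bar R) : measurable_fun setT h -> (forall w, 0 <= h w) ->
      \int[mu]_w (f_ n w * h w) @[n --> \oo] --> \int[mu]_w (f w * h w).
    move=> mh h0.
    have fh w : f_ n w * h w @[n --> \oo] --> f w * h w.
      have [f0|fN0] := eqVneq (f w) 0.
        have -> : (fun n => f_ n w * h w) = cst (f w * h w).
          apply/funext => n /=; congr (_ * _).
          apply/le_anti/andP; split; last by rewrite f0 f_0.
          rewrite (cvg_unique _ (f_f w) (ereal_nondecreasing_cvgn (f_nd w)))//.
          by apply: ereal_sup_ubound; exists n.
        exact: cvg_cst.
      have [->|hN0] := eqVneq (h w) 0.
        by under eq_fun do rewrite mule0; rewrite mule0; exact: cvg_cst.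
      apply: cvgeM => //; last exact: cvg_cst.
      by rewrite mule_defE (negbTE fN0) (negbTE hN0).
    under [X in _ --> X]eq_integral => w _ do rewrite -(cvg_lim _ (fh w))//.
    apply: cvg_monotone_convergence => //.
    - by move=> n; apply: emeasurable_funM => //; exact: mT.
    - by move=> n w _; rewrite mule_ge0.
    - by move=> w _ m n mn; rewrite lee_wpmul2r// f_nd.
  have := cv _ mf2 f20; rewrite (_ : (fun n => _) =
    (fun n => \int[mu]_w (f_ n w * f1 w))); last by apply/funext => n; rewrite hf.
  by move=> c2; apply: cvg_unique (cv _ mf1 f10) c2.
Qed.

End measure_tools.

(** Logarithm and exponential are inverse order isomorphisms between the
nonnegative and all extended reals, so they commute with infima. *)
Lemma ereal_inf_lne (R : realType) (S : set (\bar R)) (r : R) : (0 < r)%R ->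
  (forall y, S y -> r%:E <= y) -> ereal_inf S <= r%:E ->
  ereal_inf [set lne y | y in S] = (ln r)%:E.
Proof.
move=> r0 rS Sr; have lK y : 0 <= y -> expeR (lne y) = y.
  by move=> y0; apply/eqP; rewrite lneK_eq.
have er : expeR (ln r)%:E = r%:E by rewrite /= lnK.
apply/eqP; rewrite eq_le; apply/andP; split; last first.
  apply: le_ereal_inf_tmp => _ [y Sy <-]; rewrite -lee_expeR er lK; first exact: rS.
  by apply: le_trans (rS _ Sy); rewrite lee_fin ltW.
rewrite -lee_expeR er; apply: le_trans Sr; apply: le_ereal_inf_tmp => y Sy.
have y0 : 0 <= y by apply: le_trans (rS _ Sy); rewrite lee_fin ltW.
by rewrite -[leRHS]lK// lee_expeR; apply: ereal_inf_lbound; exists y.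
Qed.

(** * Riemann sums of right-continuous functions *)

Lemma cvg_from_right (R : realType) (U : topologicalType) (f : R -> U) (t : R)
    (t_ : nat -> R) : f s @[s --> t^'+] --> f t -> (forall n, (t <= t_ n)%R) ->
  t_ n @[n --> \oo] --> t -> f (t_ n) @[n --> \oo] --> f t.
Proof.
move=> fc t_ge t_t A Aft.
have fA : nbhs t (fun s => (t < s)%R -> A (f s)) := fc A Aft.
have : \forall n \near \oo, (t < t_ n)%R -> A (f (t_ n)) := t_t _ fA.
apply: filterS => n /=; have := t_ge n; rewrite le_eqVlt => /predU1P[<- _|].
  exact: nbhs_singleton.
by move=> tn; exact.
Qed.

Lemma lebesgue_measure_oc (R : realType) (a b : R) : (a < b)%R ->
  lebesgue_measure (`]a, b]%classic : set R) = (b - a)%:E.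
Proof. by move=> ab; rewrite lebesgue_measure_itv/= lte_fin ab -EFinB. Qed.

Section right_continuous.
Local Open Scope ring_scope.
Context {R : realType} (phi : R -> R) (M : R).
Hypothesis phi_rc : forall t : R, 0 <= t -> phi s @[s --> t^'+] --> phi t.
Hypothesis phi_ge0 : forall s, 0 <= phi s.
Hypothesis phi_le : forall s, phi s <= M.

Let cell (a b : R) (n : nat) : R := (b - a) / n.+1%:R.

Definition riemann_sum (a b : R) (n : nat) : R :=
  \sum_(i < n.+1) phi (a + i.+1%:R * cell a b n) * cell a b n.

Let M_ge0 : 0 <= M. Proof. exact: le_trans (phi_le 0). Qed.

(** The value of [phi] at the right end of each cell: right-continuity gives
convergence at every point, and the integral is the Riemann sum. *)
Let step (a b : R) (n : nat) (s : R) : R :=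
  \sum_(i < n.+1) phi (a + i.+1%:R * cell a b n) *
    \1_(`]a + i%:R * cell a b n, a + i.+1%:R * cell a b n]%classic) s.

Let cell_gt0 a b n : a < b -> 0 < cell a b n.
Proof. by move=> ab; rewrite divr_gt0// subr_gt0. Qed.

Let step_ge0 a b n s : 0 <= step a b n s.
Proof. by apply: sumr_ge0 => i _; rewrite mulr_ge0// indicE; case: (_ \in _). Qed.

Let stepE a b n s : a < b -> a < s <= b -> exists t : R,
  step a b n s = phi t /\ s <= t <= s + cell a b n.
Proof.
move=> ab /andP[as_ sb]; set r := cell a b n; have r0 : 0 < r by exact: cell_gt0.
have [i [i_n /andP[ai si]]] : exists i, (i < n.+1)%N /\
    a + i%:R * r < s <= a + i.+1%:R * r.
  have : s <= a + n.+1%:R * r by rewrite /r /cell mulrCA divff// mulr1 addrC subrK.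
  elim: n.+1 => [|k IH sk]; first by rewrite mul0r addr0 leNgt as_.
  have [/IH[i [ik ?]]|ks] := leP s (a + k%:R * r).
    by exists i; split => //; rewrite ltnS ltnW.
  by exists k; rewrite ltnSn ks sk.
exists (a + i.+1%:R * r); split; last first.
  rewrite si/=; move: ai; rewrite -addn1 natrD mulrDl mul1r; lra.
rewrite /step (bigD1 (Ordinal i_n))//= big1 ?addr0.
  by rewrite indicE mem_set ?mulr1//= in_itv/= ai.
move=> j ji; rewrite indicE memNset ?mulr0//= in_itv/= => /andP[aj sj].
move/eqP: ji; apply; apply/val_inj => /=; apply/eqP; rewrite eqn_leq.
apply/andP; split; rewrite -ltnS -(@ltr_nat R) -(ltr_pM2r r0) -(ltrD2l a).
  exact: lt_le_trans aj si.
exact: lt_le_trans ai sj.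
Qed.

Let step_out a b n s : a < b -> ~~ (a < s <= b) -> step a b n s = 0.
Proof.
move=> ab sab; rewrite /step big1// => i _; rewrite indicE memNset ?mulr0//=.
rewrite in_itv/= => /andP[ai si]; move/negP: sab; apply; apply/andP; split.
  by apply: le_lt_trans ai; rewrite lerDl mulr_ge0// ltW// cell_gt0.
apply: (le_trans si); rewrite -lerBrDl.
rewrite [leRHS](_ : _ = n.+1%:R * cell a b n); last by rewrite /cell mulrCA divff// mulr1.
by rewrite ler_pM2r ?cell_gt0// ler_nat.
Qed.

Let cell_cvg0 a b : cell a b n @[n --> \oo] --> (0 : R).
Proof.
by rewrite -(mulr0 (b - a)); apply: cvgM; [exact: cvg_cst|exact: cvg_harmonic].
Qed.

Let mstep a b n : measurable_fun setT (step a b n).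
Proof.
by apply: measurable_sum => i; apply: measurable_funM.
Qed.

Let phi0 a b s := phi s * \1_(`]a, b]%classic) s.

Let step_cvg (a b s : R) : 0 <= a -> a < b -> step a b ^~ s @ \oo --> phi0 a b s.
Proof.
move=> a0 ab; rewrite /phi0 indicE; have [sab|sab] := boolP (a < s <= b); last first.
  rewrite memNset /= ?in_itv/= ?(negbTE sab)// mulr0.
  by under eq_fun do rewrite step_out//; exact: cvg_cst.
rewrite mem_set/= ?in_itv// mulr1.
have /choice[t_ t_P] n := stepE n ab sab.
under eq_fun do rewrite (t_P _).1.
have s0 : 0 <= s by case/andP: sab => /ltW/(le_trans a0).
apply: cvg_from_right; first exact: phi_rc.
  by move=> n; case: (t_P n) => _ /andP[].
apply: (@squeeze_cvgr _ _ _ _ (cst s) (fun n => s + cell a b n)).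
- by apply: nearW => n; case: (t_P n).
- exact: cvg_cst.
- by rewrite -[X in _ --> X]addr0; apply: cvgD; [exact: cvg_cst|exact: cell_cvg0].
Qed.

Let mphi0 (a b : R) : 0 <= a -> a < b -> measurable_fun setT (phi0 a b).
Proof.
move=> a0 ab; apply: (measurable_fun_cvg (fun n => mstep a b n)) => s _.
exact: step_cvg.
Qed.

Lemma measurable_right_continuous (a b : R) : 0 <= a -> measurable_fun `]a, b] phi.
Proof.
move=> a0; have [ab|ba] := ltP a b; last first.
  by rewrite set_itv_ge -?leNgt//; exact: measurable_fun_set0.
have : measurable_fun `]a, b] (phi0 a b) by apply: measurable_funTS; exact: mphi0.
by apply: eq_measurable_fun => s sab; rewrite /phi0 indicE sab mulr1.
Qed.

Lemma integrable_right_continuous (a b : R) : 0 <= a ->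
  lebesgue_measure.-integrable `]a, b] (EFin \o phi).
Proof.
move=> a0; apply: measurable_bounded_integrable => //.
- have [ab|ba] := ltP a b; last by rewrite set_itv_ge -?leNgt// measure0.
  by rewrite [ltLHS](@lebesgue_measure_oc R)// ltry.
- exact: measurable_right_continuous.
- exists M; split; first exact: num_real.
  by move=> y My x _ /=; rewrite ger0_norm// (le_trans (phi_le x))// ltW.
Qed.

Definition rint (a b : R) := (\int[lebesgue_measure]_(s in `]a, b]) phi s).

Lemma riemann_sum_cvg (a b : R) : 0 <= a -> a <= b -> riemann_sum a b @ \oo --> rint a b.
Proof.
move=> a0; rewrite le_eqVlt => /predU1P[->|ab].
  rewrite /rint set_itv_ge ?bnd_simp ?ltxx// Rintegral_set0 /riemann_sum /cell.
  rewrite subrr; under eq_fun do under eq_bigr do rewrite mul0r mulr0.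
  by under eq_fun do rewrite big1//; exact: cvg_cst.
have sumE n : (\int[lebesgue_measure]_(s in `]a, b]) (step a b n s)%:E =
    (riemann_sum a b n)%:E)%E.
  rewrite /step; under eq_integral do rewrite -sumEFin.
  rewrite ge0_integral_sum//=; last 2 first.
    by move=> i; apply/measurable_EFinP/measurable_funM.
    by move=> i s _; rewrite lee_fin mulr_ge0.
  rewrite /riemann_sum -sumEFin; apply: eq_bigr => i _.
  under eq_integral do rewrite EFinM.
  rewrite ge0_integralZl_EFin//; last first.
    by apply/measurable_EFinP; exact: measurable_funTS.
  rewrite integral_indic// setIidl; last first.
    apply: subset_itv; rewrite bnd_simp.
      by rewrite lerDl mulr_ge0// ltW// cell_gt0.
    rewrite -lerBrDl [leRHS](_ : _ = n.+1%:R * cell a b n); last first.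
      by rewrite /cell mulrCA divff// mulr1.
    by rewrite ler_pM2r ?cell_gt0// ler_nat ltn_ord.
  rewrite [X in (_ * X)%E](@lebesgue_measure_oc R); last first.
    by rewrite ltrD2l ltr_pM2r ?cell_gt0// ltr_nat.
  by rewrite -EFinM; congr (_ * _)%:E; rewrite -natr1; ring.
have -> : rint a b = fine (\int[lebesgue_measure]_(s in `]a, b]) (phi0 a b s)%:E)%E.
  rewrite /rint /Rintegral; congr fine; apply: eq_integral => s sab.
  by rewrite /phi0 indicE sab mulr1.
have -> : riemann_sum a b =
    (fun n => fine (\int[lebesgue_measure]_(s in `]a, b]) (step a b n s)%:E)%E).
  by apply/funext => n; rewrite sumE.
apply: fine_cvg; have phi0_ge0 s : 0 <= phi0 a b s by rewrite mulr_ge0// indicE; case: (_ \in _).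
have Mitv : (\int[lebesgue_measure]_s (M * \1_(`]a, b]%classic) s)%:E < +oo)%E.
  under eq_integral do rewrite EFinM.
  rewrite ge0_integralZl_EFin//; last first.
    exact/measurable_EFinP.
  rewrite integral_indic// setIT [X in (_ * X)%E](@lebesgue_measure_oc R)//.
  by rewrite -EFinM ltry.
rewrite fineK; last first.
  rewrite ge0_fin_numE; last by apply: integral_ge0 => s _; rewrite lee_fin.
  apply: le_lt_trans Mitv.
  rewrite integral_mkcond; apply: ge0_le_integralT => s.
    by apply: erestrict_ge0 => x _; rewrite lee_fin.
  rewrite patchE; case: ifP => sab; last by rewrite lee_fin mulr_ge0.
  by rewrite lee_fin /phi0 indicE sab !mulr1.
apply: (ge0_dominated_cvg (mu := lebesgue_measure) (A := `]a, b]%classic)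
  (f_ := step a b) (f := phi0 a b) (h := fun s => (M * \1_(`]a, b]%classic) s)%:E)) => //.
- exact: mstep.
- by move=> s _; exact: step_cvg.
- exact: mphi0.
- move=> n s; rewrite lee_fin.
  rewrite indicE; have [sab|sab] := boolP (a < s <= b).
    have [t [-> _]] := stepE n ab sab.
    by rewrite mem_set/= ?in_itv// mulr1.
  by rewrite step_out// mulr_ge0.
- exact/measurable_EFinP/measurable_funM.
Qed.

Lemma rintD (a b c : R) : 0 <= a -> a <= b -> b <= c -> rint a c = rint a b + rint b c.
Proof.
move=> a0 ab bc.
have := @Rintegral_itvB R phi (BRight a) (BRight c) b
  (@integrable_right_continuous a c a0).
rewrite !bnd_simp => /(_ ab bc) h; rewrite /rint; apply/eqP; rewrite addrC -subr_eq; apply/eqP; exact: h.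
Qed.

Lemma riemann_sum_ge (m a b : R) n : a <= b -> (forall s, m <= phi s) ->
  m * (b - a) <= riemann_sum a b n.
Proof.
move=> ab mphi; rewrite /riemann_sum -mulr_suml.
rewrite [leLHS](_ : _ = (\sum_(i < n.+1) m) * cell a b n); last first.
  rewrite sumr_const card_ord /cell -[m *+ _]mulr_natr -mulrA; congr (_ * _).
  by rewrite mulrCA divff// mulr1.
rewrite ler_wpM2r//; last exact: ler_sum.
by rewrite divr_ge0// subr_ge0.
Qed.

Lemma riemann_sum_le (a b : R) n : a <= b -> riemann_sum a b n <= M * (b - a).
Proof.
move=> ab; rewrite /riemann_sum -mulr_suml.
rewrite [leRHS](_ : _ = (\sum_(i < n.+1) M) * cell a b n); last first.
  rewrite sumr_const card_ord /cell -[M *+ _]mulr_natr -mulrA; congr (_ * _).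
  by rewrite mulrCA divff// mulr1.
rewrite ler_wpM2r//; last exact: ler_sum.
by rewrite divr_ge0// subr_ge0.
Qed.

Lemma rint_ge (m a b : R) : 0 <= a -> a <= b -> (forall s, m <= phi s) ->
  m * (b - a) <= rint a b.
Proof.
move=> a0 ab mphi.
have cv := riemann_sum_cvg a0 ab; rewrite -(cvg_lim _ cv)//.
apply: limr_ge; first by apply/cvg_ex; eexists; exact: cv.
by apply: nearW => n; exact: riemann_sum_ge.
Qed.

Lemma rint_le (a b : R) : 0 <= a -> a <= b -> rint a b <= M * (b - a).
Proof.
move=> a0 ab.
have cv := riemann_sum_cvg a0 ab; rewrite -(cvg_lim _ cv)//.
apply: limr_le; first by apply/cvg_ex; eexists; exact: cv.
by apply: nearW => n; exact: riemann_sum_le.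
Qed.

Lemma rint_set (r : R) : 0 <= r ->
  (\int[lebesgue_measure]_(s in `[0, r]) phi s) = rint 0 r.
Proof.
move=> r0; rewrite /rint -Rintegral_itv_obnd_cbnd//.
exact: integrable_right_continuous.
Qed.

End right_continuous.

(** * First index satisfying a predicate *)

Section hitting_index.
Context {T : Type}.
Implicit Types (p : nat -> T -> bool) (w : T).

(** The value [K] means that no index below [K] qualifies. *)
Definition hit K p w := find (fun j => p j w) (iota 0 K).

Lemma hit_le K p w : (hit K p w <= K)%N.
Proof. by rewrite -[leqRHS](size_iota 0); exact: find_size. Qed.

Lemma hit_holds K p w : (hit K p w < K)%N -> p (hit K p w) w.
Proof.
move=> hK; have := hK; rewrite -[X in (_ < X)%N](size_iota 0 K) -has_find.
by move=> /(nth_find 0%N); rewrite nth_iota ?add0n.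
Qed.

Lemma hit_before K p w j : (j < hit K p w)%N -> ~~ p j w.
Proof.
move=> jh; have jK : (j < K)%N := leq_trans jh (hit_le K p w).
by have := before_find 0%N jh; rewrite nth_iota ?add0n// => ->.
Qed.

Lemma hit_min K p w j : p j w -> (hit K p w <= j)%N.
Proof. by move=> pj; rewrite leqNgt; apply/negP => /hit_before; rewrite pj. Qed.

Lemma hit_minn K i p w : (i <= K)%N -> hit i p w = minn (hit K p w) i.
Proof.
move=> iK; apply/eqP; rewrite eqn_leq; apply/andP; split.
  rewrite leq_min hit_le andbT; have [hK|] := ltnP (hit K p w) K.
    by apply: hit_min; exact: hit_holds.
  by apply: leq_trans; apply: leq_trans iK; exact: hit_le.
have [hi|] := ltnP (hit i p w) i; last by rewrite geq_min => ->; rewrite orbT.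
by rewrite geq_min hit_min// hit_holds.
Qed.

Lemma hit_le_ex K p w j : (j < K)%N -> (hit K p w <= j)%N = [exists i : 'I_j.+1, p i w].
Proof.
move=> jK; apply/idP/existsP => [hj|[i pi]]; last first.
  by apply: leq_trans (hit_min _ pi) _; rewrite -ltnS.
have hj' : (hit K p w < j.+1)%N by rewrite ltnS.
by exists (Ordinal hj') => /=; apply: hit_holds; exact: leq_ltn_trans jK.
Qed.

End hitting_index.

(** * The stopping problem *)

(** The bounds [c] and [M] of the rate [g] are parameters: the divergence of the
running cost is expressed with the first, dominations with the second. *)
Record stopping_problem (R : realType) (E : pmetricType R) (d : measure_display)
    (Omega : measurableType d) (F : R -> set (set Omega))
    (X : R -> Omega -> E) (P : E -> probability Omega R) (G g : E -> R)
    (c M : R) : Prop := StoppingProblem {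
  problem_markov : standard_markov_process F X P ;
  reward_ge0 : forall x, (0 <= G x)%R ;
  reward_continuous : continuous G ;
  rate_continuous : continuous g ;
  rate_lower_gt0 : (0 < c)%R ;
  rate_lower : forall x, (c <= g x)%R ;
  rate_upper : forall x, (g x <= M)%R ;
  reward_sup_integrable : forall (T : R) (x : E), (0 <= T)%R ->
      \int[P x]_w
        ereal_sup [set (expR (G (X t w)))%:E | t in `[0%R, T]%classic] < +oo }.

Lemma measurable_continuous_borel (R : realType) (E : pmetricType R) (f : E -> R) :
  continuous f -> measurable_fun [set: borel E] (f : borel E -> R).
Proof.
move=> /continuousP fc; apply: (measurability _ (RGenOInfty.measurableE R)).
move=> _ [_ [a ->] <-]; rewrite setTI; apply: sub_sigma_algebra.
apply: fc; exact: interval_open.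
Qed.

Section optimal_stopping.
Context {R : realType} {E : pmetricType R} {d : measure_display}
  {Omega : measurableType d}.
Context {F : R -> set (set Omega)} {X : R -> Omega -> E}
  {P : E -> probability Omega R} {G g : E -> R} {c M : R}.
Hypothesis HS : stopping_problem F X P G g c M.

Let HX := problem_markov HS.
Let HF := markov_filtration HX.
Local Notation Ft t := (g_sigma_algebraType (F t)).
Local Notation rc := (running_cost X g).
Local Notation path w := (fun s => g (X s w)).
Local Notation expG := (fun x => expR (G x)).

Lemma filtrationE t : (0 <= t)%R -> <<s F t >> = F t.
Proof. by move=> t0; exact/sigma_algebra_id/(filtration_sigma HF). Qed.

Lemma priorT t : (0 <= t)%R -> F t setT.
Proof. by move=> t0; rewrite -(filtrationE)//; exact: (@measurableT _ (Ft t)). Qed.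

Lemma priorC (t : R) A : (0 <= t)%R -> F t A -> F t (~` A).
Proof.
move=> t0; rewrite -(filtrationE)// => FA.
by apply: (@measurableC _ (Ft t)).
Qed.

Lemma priorU (t : R) A B : (0 <= t)%R -> F t A -> F t B -> F t (A `|` B).
Proof.
move=> t0; rewrite -(filtrationE)// => FA FB.
by apply: (@measurableU _ (Ft t)).
Qed.

Lemma measurable_prior (d' : measure_display) (T' : measurableType d') t (f : Omega -> T') :
  (0 <= t)%R -> measurable_fun [set: Ft t] (f : Ft t -> T') ->
  measurable_fun setT f.
Proof.
move=> t0 mf _ B mB; apply: (filtration_sub HF t0).
by rewrite -filtrationE//; exact: mf.
Qed.

Lemma measurable_prior_state t u : (0 <= u <= t)%R ->
  measurable_fun [set: Ft t] (X u : Ft t -> borel E).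
Proof.
move=> /andP[u0 ut] _ B mB; rewrite setTI.
apply: sub_sigma_algebra; apply: (filtration_mono HF (s := u)); first by rewrite u0.
exact: (markov_adapted HX).
Qed.

Lemma measurable_state u : (0 <= u)%R -> measurable_fun [set: Omega] (X u : Omega -> borel E).
Proof.
by move=> u0; apply: (@measurable_prior _ _ u) => //; apply: measurable_prior_state; rewrite u0/=.
Qed.

Lemma measurable_comp_state (d' : measure_display) (T' : measurableType d')
    (f : borel E -> T') u : (0 <= u)%R -> measurable_fun [set: borel E] f ->
  measurable_fun setT (fun w => f (X u w)).
Proof. by move=> u0 mf; exact: (measurableT_comp mf (measurable_state u0)). Qed.

Lemma measurable_rate : measurable_fun [set: borel E] (g : borel E -> R).
Proof. exact: (measurable_continuous_borel (rate_continuous HS)). Qed.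

Lemma measurable_reward : measurable_fun [set: borel E] (G : borel E -> R).
Proof. exact: (measurable_continuous_borel (reward_continuous HS)). Qed.

Lemma measurable_comp_real (f : E -> R) u : (0 <= u)%R ->
  measurable_fun [set: borel E] (f : borel E -> R) ->
  measurable_fun setT (fun w => f (X u w)).
Proof. by move=> u0 mf; exact: (measurable_comp_state u0 mf). Qed.

Lemma prior_state_le (t : R) (f1 f2 : E -> R) : (0 <= t)%R ->
  measurable_fun [set: borel E] (f1 : borel E -> R) ->
  measurable_fun [set: borel E] (f2 : borel E -> R) ->
  F t [set w | (f1 (X t w) <= f2 (X t w))%R].
Proof.
move=> t0 m1 m2; apply: (markov_adapted HX t0 (B := [set x | (f1 x <= f2 x)%R])).
have h := measurable_fun_ler m1 m2.
by rewrite -[X in measurable X]setTI; exact: (h measurableT [set true]).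
Qed.

(** The process starts at [x] almost surely under [P x], so a function that is
constant on this event integrates to its value there. *)
Lemma integral_start x (f : Omega -> \bar R) (y : \bar R) : (forall w, 0 <= f w) -> 0 <= y ->
  measurable_fun setT f -> (forall w, X 0 w = x -> f w = y) ->
  \int[P x]_w f w = y.
Proof.
move=> f0 y0 mf fy.
have mX0 : measurable (X 0 @^-1` [set x]).
  rewrite -[X in measurable X]setTI; apply: (measurable_state (lexx _)) => //.
  rewrite -[X in measurable X]setCK; apply: measurableC.
  apply: sub_sigma_algebra; apply: closed_openC.
  exact/accessible_closed_set1/hausdorff_accessible/metric_hausdorff.
rewrite (@ge0_ae_eq_integral _ _ _ (P x) setT f (cst y))//.
  by rewrite integral_cst// [X in _ * X](probability_setT (P x)) mule1.
exists (~` (X 0 @^-1` [set x])); split; first exact: measurableC.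
  have /= -> := probability_setC (P x) mX0.
  by rewrite [X in 1 - X](markov_start HX x) subee.
move=> w /= nf; apply: contra_not nf => X0 _; exact: fy.
Qed.

(** * The running cost *)

Lemma rate_ge0 x : (0 <= g x)%R.
Proof. by apply: le_trans (rate_lower HS x); exact/ltW/(rate_lower_gt0 HS). Qed.

Lemma state_right_cvg w t : (0 <= t)%R -> X s w @[s --> t^'+] --> X t w.
Proof. by move=> t0; apply: (markov_cadlag HX w).1. Qed.

Lemma rate_right_cvg w (t : R) : (0 <= t)%R -> path w s @[s --> t^'+] --> path w t.
Proof.
move=> t0; apply: (cvg_comp (X ^~ w) g (state_right_cvg t0)).
exact: (rate_continuous HS).
Qed.

Lemma running_costE w r : (0 <= r)%R -> rc r w = rint (path w) 0 r.
Proof.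
move=> r0; rewrite /running_cost.
apply: (@rint_set R (path w) M) => //; [exact: rate_right_cvg|
  by move=> s; exact: rate_ge0|by move=> s; exact: (rate_upper HS)].
Qed.

Lemma running_cost_add w s r : (0 <= s)%R -> (0 <= r)%R ->
  rc (s + r) w = (rc s w + rint (path w) s (s + r))%R.
Proof.
move=> s0 r0; rewrite !running_costE ?addr_ge0//.
apply: (@rintD R (path w) M) => //; [exact: rate_right_cvg|
  by move=> u; exact: rate_ge0|by move=> u; exact: (rate_upper HS)|
  by rewrite lerDl].
Qed.

Lemma rint_rate_ge w s r : (0 <= s)%R -> (0 <= r)%R ->
  (c * r <= rint (path w) s (s + r))%R.
Proof.
move=> s0 r0; rewrite [leLHS](_ : _ = c * ((s + r) - s))%R; last by rewrite addrAC subrr add0r.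
apply: (@rint_ge R (path w) M) => //; [exact: rate_right_cvg|
  by move=> u; exact: rate_ge0|by move=> u; exact: (rate_upper HS)|
  by rewrite lerDl|by move=> u; exact: (rate_lower HS)].
Qed.

Lemma rint_rate_le w s r : (0 <= s)%R -> (0 <= r)%R ->
  (rint (path w) s (s + r) <= M * r)%R.
Proof.
move=> s0 r0; rewrite [leRHS](_ : _ = M * ((s + r) - s))%R; last by rewrite addrAC subrr add0r.
apply: (@rint_le R (path w) M) => //; [exact: rate_right_cvg|
  by move=> u; exact: rate_ge0|by move=> u; exact: (rate_upper HS)|
  by rewrite lerDl].
Qed.

Lemma riemann_rate_cvg w s r : (0 <= s)%R -> (0 <= r)%R ->
  riemann_sum (path w) s (s + r) @ \oo --> rint (path w) s (s + r).
Proof.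
move=> s0 r0; apply: (@riemann_sum_cvg R (path w) M) => //; [exact: rate_right_cvg|
  by move=> u; exact: rate_ge0|by move=> u; exact: (rate_upper HS)|
  by rewrite lerDl].
Qed.

Lemma running_cost0 w : rc 0 w = 0%R.
Proof. by rewrite running_costE// /rint set_itv_ge ?bnd_simp ?ltxx// Rintegral_set0. Qed.

Lemma running_cost_ge w r : (0 <= r)%R -> (c * r <= rc r w)%R.
Proof. by move=> r0; rewrite running_costE// -[X in rint _ _ X]add0r; exact: rint_rate_ge. Qed.

Lemma running_cost_le w r : (0 <= r)%R -> (rc r w <= M * r)%R.
Proof. by move=> r0; rewrite running_costE// -[X in rint _ _ X]add0r; exact: rint_rate_le. Qed.

Lemma measurable_prior_riemann t s r n : (0 <= s)%R -> (0 <= r)%R -> (s + r <= t)%R ->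
  measurable_fun [set: Ft t] (fun w : Ft t => riemann_sum (path w) s (s + r) n).
Proof.
move=> s0 r0 srt; apply: measurable_sum => i; apply: measurable_funM => //.
apply: (measurableT_comp (f := g : borel E -> R)).
  exact: (measurable_continuous_borel (rate_continuous HS)).
apply: measurable_prior_state; rewrite addrAC subrr add0r mulrA.
have ri : (i.+1%:R * r / n.+1%:R <= r)%R.
  by rewrite ler_pdivrMr// mulrC ler_wpM2l// ler_nat.
rewrite addr_ge0//=; last by rewrite divr_ge0// mulr_ge0.
by apply: le_trans srt; rewrite lerD2l.
Qed.

Lemma measurable_prior_running_cost t : (0 <= t)%R ->
  measurable_fun [set: Ft t] (rc t : Ft t -> R).
Proof.
move=> t0.
apply: (@measurable_fun_cvg _ (Ft t) _ _ (fun n (w : Ft t) => riemann_sum (path w) 0 (0 + t) n)).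
  by move=> n; apply: measurable_prior_riemann => //; rewrite add0r.
move=> w _; rewrite running_costE// -[X in rint _ _ X]add0r.
exact: riemann_rate_cvg.
Qed.

Lemma measurable_running_cost t : (0 <= t)%R -> measurable_fun setT (rc t).
Proof. by move=> t0; apply: (measurable_prior t0); exact: measurable_prior_running_cost. Qed.

Lemma riemann_rate_bounds w s r n : (0 <= r)%R ->
  (0 <= riemann_sum (path w) s (s + r) n <= M * r)%R.
Proof.
move=> r0; have sr : (s <= s + r)%R by rewrite lerDl.
have -> : (M * r = M * ((s + r) - s))%R by rewrite addrAC subrr add0r.
have := @riemann_sum_le R (path w) M (fun u => rate_upper HS (X u w)) s (s + r)%R n sr.
have := @riemann_sum_ge R (path w) 0 s (s + r)%R n sr (fun u => rate_ge0 (X u w)).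
by rewrite mul0r => -> ->.
Qed.

Lemma measurable_riemann_rate s r n : (0 <= s)%R -> (0 <= r)%R ->
  measurable_fun setT (fun w => riemann_sum (path w) s (s + r) n).
Proof.
move=> s0 r0; apply: (measurable_prior (addr_ge0 s0 r0)).
exact: measurable_prior_riemann.
Qed.

(** * Markov property and Feynman-Kac operators *)

Definition transition (r : R) (f : E -> \bar R) (y : E) : \bar R := \int[P y]_w f (X r w).

Lemma transition_ge0 r f y : (forall x, 0 <= f x) -> 0 <= transition r f y.
Proof. by move=> f0; apply: integral_ge0 => w _. Qed.

(** The strong Markov property at the constant time [s] is the case of an
indicator; sums, multiples and increasing limits follow. *)
Lemma markov_transition (r : R) (f : borel E -> \bar R) : (0 <= r)%R ->
  measurable_fun [set: borel E] f -> (forall x, 0 <= f x) ->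
  measurable_fun [set: borel E] (transition r f : borel E -> \bar R) /\
  forall x s A, (0 <= s)%R -> F s A ->
  \int[P x]_(w in A) f (X (s + r) w) = \int[P x]_(w in A) transition r f (X s w).
Proof.
move=> r0; move: f; apply: ge0_measurable_ind.
- move=> B mB.
  have tE : transition r (fun x => (\1_B x)%:E) = (fun y => P y (X r @^-1` B)).
    apply/funext => y; rewrite /transition.
    transitivity (P y (X r @^-1` B `&` setT)); last by rewrite setIT.
    rewrite -integral_indic//.
    by rewrite -[X in measurable X]setTI; exact: measurable_state.
  split; first by rewrite tE; exact: (markov_kernel HX).
  move=> x s A s0 FA; rewrite tE.
  have mA : measurable A by exact: (filtration_sub HF) FA.
  have := @markov_strong _ _ _ _ _ _ _ HX x (cst s%:E) r A B.
  rewrite (_ : [set w | cst s%:E w < +oo] = setT) ?setIT; last first.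
    by apply/seteqP; split => // w _ /=; exact: ltry.
  move=> <- //; last 2 first.
  - split=> [w|t t0 /=]; first by rewrite lee_fin.
    have [st|ts] := leP s t.
      rewrite (_ : [set _ | _] = setT); last by apply/seteqP; split => // w _ /=; rewrite lee_fin.
      by rewrite -filtrationE//; exact: (@measurableT _ (Ft t)).
    rewrite (_ : [set _ | _] = set0).
      by rewrite -filtrationE//; exact: (@measurable0 _ (Ft t)).
    by apply/seteqP; split => // w /=; rewrite lee_fin leNgt ts.
  - split => // t t0; have [st|ts] := leP s t.
      rewrite (_ : [set _ | _] = setT) ?setIT; last by apply/seteqP; split => // w _ /=; rewrite lee_fin.
      by apply: (filtration_mono HF) FA; rewrite s0.
    rewrite (_ : [set _ | _] = set0) ?setI0.
      by rewrite -filtrationE//; exact: (@measurable0 _ (Ft t)).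
    by apply/seteqP; split => // w /=; rewrite lee_fin leNgt ts.
  rewrite (_ : [set _ | _] = X (s + r) @^-1` B); last first.
    by apply/seteqP; split => w /= => [[]|]//; split=> //; exact: ltry.
  rewrite setIC -integral_indic//.
  by rewrite -[X in measurable X]setTI; apply: measurable_state => //; exact: addr_ge0.
- move=> f1 f2 mf1 mf2 f10 f20 [mt1 h1] [mt2 h2].
  have mc (f : borel E -> \bar R) (u : R) : measurable_fun [set: borel E] f -> (0 <= u)%R ->
      measurable_fun setT (fun w => f (X u w)).
    by move=> mf u0; exact: (measurable_comp_state u0 mf).
  have tD : transition r (fun x => f1 x + f2 x) = fun y => transition r f1 y + transition r f2 y.
    by apply/funext => y; rewrite /transition ge0_integralD//; exact: mc.
  split; first by rewrite tD; exact: emeasurable_funD.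
  move=> x s A s0 FA; rewrite tD.
  have mA : measurable A by exact: (filtration_sub HF) FA.
  have sr0 : (0 <= s + r)%R by exact: addr_ge0.
  rewrite [LHS]ge0_integralD//; try (by apply: measurable_funTS; exact: mc).
  rewrite [RHS]ge0_integralD//; try (by apply: measurable_funTS; exact: mc);
    try (by move=> *; exact: transition_ge0).
  by rewrite h1// h2.
- move=> a f1 a0 mf1 f10 [mt1 h1].
  have mc (u : R) : (0 <= u)%R -> measurable_fun setT (fun w => f1 (X u w)).
    by move=> u0; exact: (measurable_comp_state u0 mf1).
  have tZ : transition r (fun x => a%:E * f1 x) = fun y => a%:E * transition r f1 y.
    by apply/funext => y; rewrite /transition ge0_integralZl_EFin//; exact: mc.
  split; first by rewrite tZ; exact: measurable_funeM.
  move=> x s A s0 FA; rewrite tZ.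
  have mA : measurable A by exact: (filtration_sub HF) FA.
  have sr0 : (0 <= s + r)%R by exact: addr_ge0.
  rewrite [LHS]ge0_integralZl_EFin//; try (by apply: measurable_funTS; exact: mc).
  rewrite [RHS]ge0_integralZl_EFin//; try (by move=> *; exact: transition_ge0).
    by rewrite h1.
  by apply: measurable_funTS; exact: (measurable_comp_state s0 mt1).
- move=> f_ f mf_ f_0 f_nd f_f h.
  have mc n (u : R) : (0 <= u)%R -> measurable_fun setT (fun w => f_ n (X u w)).
    by move=> u0; exact: (measurable_comp_state u0 (mf_ n)).
  have fE x : f x = limn (f_ ^~ x) by rewrite -(cvg_lim _ (f_f x)).
  have tcv y : transition r (f_ n) y @[n --> \oo] --> transition r f y.
    rewrite /transition; under [X in _ --> X]eq_integral do rewrite fE.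
    apply: cvg_monotone_convergence => //.
    by move=> n; exact: mc.
  have mt : measurable_fun [set: borel E] (transition r f : borel E -> \bar R).
    apply: (@emeasurable_fun_cvg _ (borel E) _ _ (fun n => transition r (f_ n))).
      by move=> n; exact: (h n).1.
    by move=> y _; exact: tcv.
  split => // x s A s0 FA.
  have mA : measurable A by exact: (filtration_sub HF) FA.
  have sr0 : (0 <= s + r)%R by exact: addr_ge0.
  have c1 : \int[P x]_(w in A) f_ n (X (s + r) w) @[n --> \oo] -->
      \int[P x]_(w in A) f (X (s + r) w).
    under [X in _ --> X]eq_integral do rewrite fE.
    apply: cvg_monotone_convergence => //.
    by move=> n; apply: measurable_funTS; exact: mc.
  have c2 : \int[P x]_(w in A) transition r (f_ n) (X s w) @[n --> \oo] -->
      \int[P x]_(w in A) transition r f (X s w).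
    under [X in _ --> X]eq_integral => w _ do rewrite -(cvg_lim _ (tcv (X s w)))//.
    apply: cvg_monotone_convergence => //.
    - move=> n; apply: measurable_funTS.
      exact: (measurable_comp_state s0 (h n).1).
    - by move=> n w _; exact: transition_ge0.
    - move=> w _ m n mn; apply: ge0_le_integralT => // u; exact: f_nd.
  apply: cvg_unique c1 _ => //.
  rewrite (_ : (fun n => _) = (fun n => \int[P x]_(w in A) transition r (f_ n) (X s w)))//.
  by apply/funext => n; exact: (h n).2.
Qed.

Lemma measurable_transition (r : R) (f : borel E -> \bar R) : (0 <= r)%R ->
  measurable_fun [set: borel E] f -> (forall x, 0 <= f x) ->
  measurable_fun [set: borel E] (transition r f : borel E -> \bar R).
Proof. by move=> r0 mf f0; have [] := markov_transition r0 mf f0. Qed.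

(** Identities over all events prior to [t] extend to weights measurable with
respect to them; the weight of interest is the exponential of the running cost
up to [t]. *)
Lemma integral_prior_weight (t : R) (x : E) (Y : Omega -> R) (A : set Omega)
    (f1 f2 : Omega -> \bar R) :
  (0 <= t)%R -> F t A -> (forall w, (0 <= Y w)%R) ->
  measurable_fun [set: Ft t] (Y : Ft t -> R) ->
  measurable_fun setT f1 -> measurable_fun setT f2 ->
  (forall w, 0 <= f1 w) -> (forall w, 0 <= f2 w) ->
  (forall B, F t B -> \int[P x]_(w in B) f1 w = \int[P x]_(w in B) f2 w) ->
  \int[P x]_(w in A) ((Y w)%:E * f1 w) = \int[P x]_(w in A) ((Y w)%:E * f2 w).
Proof.
move=> t0 FA Y0 mY mf1 mf2 f10 f20 f12.
have e h : \int[P x]_(w in A) ((Y w)%:E * h w) =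
    \int[P x]_w (((\1_A w)%:E * (Y w)%:E) * h w).
  rewrite integral_mkcond epatch_indic; apply: eq_integral => w _ /=.
  by rewrite muleC muleA.
rewrite !e; apply: (integral_weight (F := F t)) => //.
- exact: (filtration_sigma HF).
- exact: (filtration_sub HF).
- by move=> w; rewrite -EFinM lee_fin mulr_ge0// indicE; case: (_ \in _).
- apply: emeasurable_funM; apply/measurable_EFinP => //.
  apply: measurable_indic.
  by change (<<s F t >> A); rewrite filtrationE.
Qed.

Lemma markov_weight (t r : R) (x : E) (Y : Omega -> R) (A : set Omega) (f : borel E -> \bar R) :
  (0 <= t)%R -> (0 <= r)%R -> F t A -> (forall w, (0 <= Y w)%R) ->
  measurable_fun [set: Ft t] (Y : Ft t -> R) ->
  measurable_fun [set: borel E] f -> (forall x, 0 <= f x) ->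
  \int[P x]_(w in A) ((Y w)%:E * f (X (t + r) w)) =
  \int[P x]_(w in A) ((Y w)%:E * transition r f (X t w)).
Proof.
move=> t0 r0 FA Y0 mY mf f0.
have [mt ht] := markov_transition r0 mf f0.
apply: (integral_prior_weight (t := t)) => //.
- by apply: (measurable_comp_state _ mf); exact: addr_ge0.
- exact: (measurable_comp_state _ mt).
- by move=> w; exact: transition_ge0.
- by move=> B FB; exact: ht.
Qed.

Definition state_sum (s r : R) (N : nat) (w : Omega) : R :=
  (\sum_(i < N) g (X (s + i.+1%:R * r) w) * r)%R.

Lemma riemann_state_sum s r n w :
  riemann_sum (path w) s (s + r) n = state_sum s (r / n.+1%:R) n.+1 w.
Proof. by rewrite /riemann_sum addrAC subrr add0r. Qed.

Lemma measurable_prior_state_sum t s r N : (0 <= s)%R -> (0 <= r)%R -> (s + N%:R * r <= t)%R ->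
  measurable_fun [set: Ft t] (state_sum s r N : Ft t -> R).
Proof.
move=> s0 r0 srt; apply: measurable_sum => i; apply: measurable_funM => //.
apply: (measurableT_comp measurable_rate); apply: measurable_prior_state.
rewrite addr_ge0//= ?mulr_ge0//.
by apply: le_trans srt; rewrite lerD2l ler_wpM2r// ler_nat.
Qed.

(** One node of a Riemann sum: iterating [N] times integrates the exponential of
the Riemann sum of the rate with [N] cells of length [r]. *)
Definition kac_step (r : R) (f : E -> \bar R) : E -> \bar R :=
  transition r (fun z => (expR (g z * r))%:E * f z).

Lemma measurable_kac_iter (r : R) N (f : borel E -> \bar R) : (0 <= r)%R ->
  measurable_fun [set: borel E] f -> (forall x, 0 <= f x) ->
  measurable_fun [set: borel E] (iter N (kac_step r) f : borel E -> \bar R) /\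
  forall x, 0 <= iter N (kac_step r) f x.
Proof.
move=> r0 mf f0; elim: N => [//|N [mN N0]].
split=> [|x]; rewrite iterS; last by apply: transition_ge0 => y; rewrite mule_ge0// lee_fin.
apply: measurable_transition => //; last by move=> y; rewrite mule_ge0// lee_fin.
apply: emeasurable_funM => //; apply/measurable_EFinP.
by apply: measurableT_comp => //; apply: measurable_funM => //; exact: measurable_rate.
Qed.

Lemma markov_iter (r : R) N (f : borel E -> \bar R) (x : E) (s : R) (A : set Omega) :
  (0 <= r)%R -> (0 <= s)%R ->
  measurable_fun [set: borel E] f -> (forall x, 0 <= f x) -> F s A ->
  \int[P x]_(w in A) ((expR (state_sum s r N w))%:E * f (X (s + N%:R * r) w)) =
  \int[P x]_(w in A) iter N (kac_step r) f (X s w).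
Proof.
move=> r0 s0; elim: N f => [|N IH] f mf f0 FA.
  apply: eq_integral => w _; rewrite /state_sum big_ord0 expR0 mul1e.
  by rewrite mul0r addr0.
rewrite iterSr -IH//; last 2 first.
- by have [] := measurable_kac_iter 1 r0 mf f0.
- by have [] := measurable_kac_iter 1 r0 mf f0.
have Nr0 : (0 <= s + N%:R * r)%R by rewrite addr_ge0// mulr_ge0.
rewrite [RHS](_ : _ = \int[P x]_(w in A) ((expR (state_sum s r N w))%:E *
   transition r (fun z => (expR (g z * r))%:E * f z) (X (s + N%:R * r) w)))//.
rewrite -markov_weight//.
- apply: eq_integral => w _.
  rewrite /state_sum big_ord_recr/= expRD EFinM -muleA.
  have -> : (s + N.+1%:R * r = s + N%:R * r + r)%R by rewrite -natr1; ring.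
  by [].
- by apply: (filtration_mono HF) FA; rewrite s0/= lerDl mulr_ge0.
- exact: measurableT_comp (measurable_prior_state_sum _ _ _).
- apply: emeasurable_funM => //; apply/measurable_EFinP.
  by apply: measurableT_comp => //; apply: measurable_funM => //; exact: measurable_rate.
- by move=> y; rewrite mule_ge0// lee_fin.
Qed.

Lemma reward_integrable x t : (0 <= t)%R -> \int[P x]_w (expR (G (X t w)))%:E < +oo.
Proof.
move=> t0; apply: le_lt_trans (reward_sup_integrable HS x t0).
apply: ge0_le_integralT => w; first by rewrite lee_fin.
by apply: ereal_sup_ubound; exists t => //=; rewrite in_itv/= t0 lexx.
Qed.

(** The Feynman-Kac operator of the process with potential [g]. *)
Definition kac (r : R) (f : E -> R) (y : E) : \bar R :=
  \int[P y]_w (expR (rc r w) * f (X r w))%:E.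

(** Exponentials of the functions with values between [0] and [G]. All terminal
rewards and all value functions are of this kind, and the upper bound makes
their expectations finite. *)
Definition admissible (f : E -> R) :=
  measurable_fun [set: borel E] (f : borel E -> R) /\
  forall x, (1 <= f x <= expR (G x))%R.

Lemma admissible_ge0 f x : admissible f -> (0 <= f x)%R.
Proof. by move=> [_ /(_ x)/andP[f1 _]]; apply: le_trans f1. Qed.

(** The Markov property at every node of the subdivision, started from time [0]. *)
Lemma kac_iterE (r : R) f y n : (0 <= r)%R -> admissible f ->
  iter n.+1 (kac_step (r / n.+1%:R)) (EFin \o f) y =
  \int[P y]_w (expR (riemann_sum (path w) 0 (0 + r) n) * f (X r w))%:E.
Proof.
move=> r0 af; have f0 x := admissible_ge0 x af; have mf := af.1.
set q := (r / n.+1%:R)%R; have q0 : (0 <= q)%R by rewrite divr_ge0.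
have mEf : measurable_fun [set: borel E] (EFin \o f : borel E -> \bar R).
  exact/measurable_EFinP.
have Ef0 x : 0 <= (EFin \o f) x by rewrite /= lee_fin.
have [mI I0] := measurable_kac_iter n.+1 q0 mEf Ef0.
rewrite -[LHS](@integral_start y
   (fun w => iter n.+1 (kac_step q) (EFin \o f) (X 0 w)))//; last 2 first.
- exact: (measurable_comp_state (lexx _) mI).
- by move=> w ->.
rewrite -(markov_iter n.+1 _ q0 (lexx _) mEf Ef0 (priorT (lexx _))).
apply: eq_integral => w _; rewrite riemann_state_sum EFinM add0r.
by rewrite /q mulrCA divff// mulr1.
Qed.

Lemma measurable_reward_state r : (0 <= r)%R ->
  measurable_fun setT (fun w => (expR (G (X r w)))%:E).
Proof.
move=> r0; apply/measurable_EFinP; apply: measurableT_comp => //.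
exact: measurable_comp_real measurable_reward.
Qed.

Lemma scaled_reward_integrable (K r : R) y : (0 <= K)%R -> (0 <= r)%R ->
  \int[P y]_w (K%:E * (expR (G (X r w)))%:E) < +oo.
Proof.
move=> K0 r0; rewrite ge0_integralZl_EFin//; last exact: measurable_reward_state.
by apply: lte_mul_pinfty; rewrite ?lee_fin//; exact: reward_integrable.
Qed.

Let rewardE (x : E) : \bar R := (expR (G x))%:E.

Let mrewardE : measurable_fun [set: borel E] (rewardE : borel E -> \bar R).
Proof. by apply/measurable_EFinP; apply: measurableT_comp => //; exact: measurable_reward. Qed.

Let rewardE_ge0 x : 0 <= rewardE x. Proof. by rewrite lee_fin expR_ge0. Qed.

Lemma kac_bound (r : R) y f : (0 <= r)%R -> admissible f ->
  kac r f y <= (expR (M * r))%:E * transition r rewardE y.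
Proof.
move=> r0 af; rewrite /transition -ge0_integralZl_EFin ?expR_ge0//; last first.
  exact: measurable_reward_state.
apply: ge0_le_integralT => w; first by rewrite lee_fin mulr_ge0 ?expR_ge0// admissible_ge0.
rewrite -EFinM lee_fin ler_pM ?expR_ge0 ?admissible_ge0//.
  by rewrite ler_expR running_cost_le.
by case/andP: (af.2 (X r w)).
Qed.

Lemma kac_iter_bound (r : R) y n f : (0 <= r)%R -> admissible f ->
  iter n.+1 (kac_step (r / n.+1%:R)) (EFin \o f) y <= (expR (M * r))%:E * transition r rewardE y.
Proof.
move=> r0 af; rewrite kac_iterE// /transition -ge0_integralZl_EFin ?expR_ge0//; last first.
  exact: measurable_reward_state.
apply: ge0_le_integralT => w; first by rewrite lee_fin mulr_ge0 ?expR_ge0// admissible_ge0.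
rewrite -EFinM lee_fin ler_pM ?expR_ge0 ?admissible_ge0//.
  by rewrite ler_expR; case/andP: (riemann_rate_bounds w 0 n r0).
by case/andP: (af.2 (X r w)).
Qed.

(** The Riemann sums converge along every path and are at most [M * r], so the
convergence is dominated; as a limit of iterated transitions, [kac r f] is then
measurable. *)
Lemma kac_iter_cvg (r : R) f y : (0 <= r)%R -> admissible f ->
  iter n.+1 (kac_step (r / n.+1%:R)) (EFin \o f) y @[n --> \oo] --> kac r f y.
Proof.
move=> r0 af; have f0 x := admissible_ge0 x af; have mf := af.1.
under eq_fun do rewrite kac_iterE//.
apply: (ge0_dominated_cvg (h := fun w => (expR (M * r))%:E * (expR (G (X r w)))%:E)) => //.
- move=> n; apply: measurable_funM.
    by apply: measurableT_comp => //; exact: measurable_riemann_rate.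
  exact: measurable_comp_real.
- move=> w _; apply: cvgM; last exact: cvg_cst.
  apply: continuous_cvg; first exact: continuous_expR.
  rewrite running_costE// -[X in rint _ _ X]add0r.
  exact: riemann_rate_cvg.
- apply: measurable_funM; last exact: measurable_comp_real.
  by apply: measurableT_comp => //; exact: measurable_running_cost.
- by move=> n w; rewrite mulr_ge0// expR_ge0.
- move=> n w; rewrite -EFinM lee_fin ler_pM// ?expR_ge0//.
    by rewrite ler_expR; case/andP: (riemann_rate_bounds w 0 n r0).
  by case/andP: (af.2 (X r w)).
- by apply: measurable_funeM; exact: measurable_reward_state.
- by apply: scaled_reward_integrable => //; exact: expR_ge0.
Qed.

Lemma measurable_kac (r : R) f : (0 <= r)%R -> admissible f ->
  measurable_fun [set: borel E] (kac r f : borel E -> \bar R).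
Proof.
move=> r0 af.
apply: (@emeasurable_fun_cvg _ (borel E) _ _
  (fun n => iter n.+1 (kac_step (r / n.+1%:R)) (EFin \o f) : borel E -> \bar R)).
  move=> n; apply: (measurable_kac_iter _ _ _ _).1 => //.
  - by rewrite divr_ge0.
  - by apply/measurable_EFinP; exact: af.1.
  - by move=> x; rewrite /= lee_fin admissible_ge0.
by move=> y _; exact: kac_iter_cvg.
Qed.

(** Replacing the cost accumulated after [s] by its Riemann sums reduces the claim
to [markov_iter], where the cost accumulated up to [s] enters as a weight. Both
sides converge under an integrable bound. *)
Lemma markov_kac (s r : R) f x A : (0 <= s)%R -> (0 <= r)%R -> admissible f -> F s A ->
  \int[P x]_(w in A) (expR (rc (s + r) w) * f (X (s + r) w))%:E =
  \int[P x]_(w in A) ((expR (rc s w))%:E * kac r f (X s w)).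
Proof.
move=> s0 r0 af FA; have f0 y := admissible_ge0 y af; have mf := af.1.
have sr0 : (0 <= s + r)%R by exact: addr_ge0.
have mA : measurable A by exact: (filtration_sub HF) FA.
have mrcs : measurable_fun setT (fun w => expR (rc s w)).
  by apply: measurableT_comp => //; exact: measurable_running_cost.
pose I n := iter n.+1 (kac_step (r / n.+1%:R)) (EFin \o f).
have mEf : measurable_fun [set: borel E] (EFin \o f : borel E -> \bar R).
  exact/measurable_EFinP.
have Ef0 y : 0 <= (EFin \o f) y by rewrite /= lee_fin.
have q0 n : (0 <= r / n.+1%:R)%R by rewrite divr_ge0.
have mI n : measurable_fun [set: borel E] (I n : borel E -> \bar R).
  exact: (measurable_kac_iter _ (q0 n) mEf Ef0).1.
have I0 n y : 0 <= I n y by exact: (measurable_kac_iter _ (q0 n) mEf Ef0).2.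
have kac0 y : 0 <= kac r f y.
  by apply: integral_ge0 => w _; rewrite lee_fin mulr_ge0// expR_ge0.
have cI : \int[P x]_(w in A) ((expR (rc s w))%:E * I n (X s w)) @[n --> \oo] -->
    \int[P x]_(w in A) ((expR (rc s w))%:E * kac r f (X s w)).
  have mtr : measurable_fun setT (fun w => transition r rewardE (X s w)).
    by apply: (measurable_comp_state s0); exact: measurable_transition.
  apply: (ge0_dominated_cvge (h := fun w => (expR (M * s))%:E *
    ((expR (M * r))%:E * transition r rewardE (X s w)))) => //.
  - move=> n; apply: emeasurable_funM; first exact/measurable_EFinP.
    exact: (measurable_comp_state s0 (mI n)).
  - by move=> w _; apply: cvgeZl => //; exact: kac_iter_cvg.
  - apply: emeasurable_funM; first exact/measurable_EFinP.
    by apply: (measurable_comp_state s0); exact: measurable_kac.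
  - by move=> n w; rewrite mule_ge0// lee_fin expR_ge0.
  - move=> n w; apply: lee_pmul => //.
      by rewrite lee_fin ler_expR running_cost_le.
    exact: kac_iter_bound.
  - by do 2 apply: measurable_funeM.
  - have tr0 y : 0 <= transition r rewardE y by exact: transition_ge0.
    rewrite ge0_integralZl_EFin ?expR_ge0//; last 2 first.
    + by move=> w _; rewrite mule_ge0// lee_fin expR_ge0.
    + exact: measurable_funeM.
    apply: lte_mul_pinfty; rewrite ?lee_fin ?expR_ge0//.
    rewrite ge0_integralZl_EFin ?expR_ge0//.
    apply: lte_mul_pinfty; rewrite ?lee_fin ?expR_ge0//.
    have [_ <-//] := markov_transition r0 mrewardE rewardE_ge0.
      exact: reward_integrable.
    exact: priorT.
have cR : \int[P x]_(w in A) ((expR (rc s w))%:E *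
      (expR (riemann_sum (path w) s (s + r) n) * f (X (s + r) w))%:E) @[n --> \oo] -->
    \int[P x]_(w in A) (expR (rc (s + r) w) * f (X (s + r) w))%:E.
  have msf := measurable_comp_real sr0 mf.
  apply: (ge0_dominated_cvg (h := fun w => (expR (M * (s + r)))%:E * (expR (G (X (s + r) w)))%:E)) => //.
  - move=> n; apply: measurable_funM; first exact: mrcs.
    apply: measurable_funM; last exact: msf.
    by apply: measurableT_comp => //; exact: measurable_riemann_rate.
  - move=> w _; rewrite running_cost_add// expRD -mulrA.
    apply: cvgM; first exact: cvg_cst.
    apply: cvgM; last exact: cvg_cst.
    apply: continuous_cvg; first exact: continuous_expR.
    exact: riemann_rate_cvg.
  - apply: measurable_funM; last exact: msf.
    by apply: measurableT_comp => //; exact: measurable_running_cost.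
  - by move=> n w; rewrite mulr_ge0 ?expR_ge0// mulr_ge0// expR_ge0.
  - move=> n w; rewrite -!EFinM lee_fin mulrA -expRD ler_pM// ?expR_ge0//.
      rewrite ler_expR mulrDr lerD// ?running_cost_le//.
      by case/andP: (riemann_rate_bounds w s n r0).
    by case/andP: (af.2 (X (s + r) w)).
  - by apply: measurable_funeM; exact: measurable_reward_state.
  - by apply: scaled_reward_integrable => //; exact: expR_ge0.
apply: cvg_unique cR _ => //.
rewrite (_ : (fun n => _) = (fun n => \int[P x]_(w in A) ((expR (rc s w))%:E * I n (X s w))))//.
apply/funext => n; apply: (integral_prior_weight (t := s)) => //.
- by apply: measurableT_comp => //; exact: measurable_prior_running_cost.
- apply/measurable_EFinP; apply: measurable_funM; last exact: measurable_comp_real.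
  by apply: measurableT_comp => //; exact: measurable_riemann_rate.
- exact: (measurable_comp_state s0 (mI n)).
- by move=> w; rewrite lee_fin mulr_ge0// expR_ge0.
- move=> B FB; rewrite -(markov_iter n.+1 _ (q0 n) s0 mEf Ef0 FB).
apply: eq_integral => w _; rewrite riemann_state_sum EFinM.
by rewrite [in RHS]mulrCA divff// mulr1.
Qed.

Local Open Scope ring_scope.
Local Notation one := (@cst E R 1).

Lemma running_cost_ge0 w r : 0 <= r -> 0 <= rc r w.
Proof.
move=> r0; apply: le_trans (running_cost_ge w r0).
by rewrite mulr_ge0// ltW// (rate_lower_gt0 HS).
Qed.

Lemma kac_ge1 r f x : 0 <= r -> admissible f -> (1 <= kac r f x)%E.
Proof.
move=> r0 af; rewrite -[leLHS](_ : \int[P x]_w (cst 1%E w) = 1)%E; last first.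
  by rewrite integral_cst// [X in (_ * X)%E](probability_setT (P x)) mule1.
apply: ge0_le_integralT => w; rewrite /cst ?lee_fin//.
rewrite -[leLHS]mulr1 ler_pM//; last by case/andP: (af.2 (X r w)).
by rewrite -expR0 ler_expR running_cost_ge0.
Qed.

Lemma kac_fin r f x : 0 <= r -> admissible f -> kac r f x \is a fin_num.
Proof.
move=> r0 af; rewrite ge0_fin_numE; last by apply: le_trans (kac_ge1 x r0 af).
apply: (le_lt_trans (kac_bound x r0 af)).
by apply: lte_mul_pinfty; rewrite ?lee_fin ?expR_ge0//; exact: reward_integrable.
Qed.

Lemma le_kac r f f' x : admissible f -> (forall x, f x <= f' x) ->
  (kac r f x <= kac r f' x)%E.
Proof.
move=> af ff'; apply: ge0_le_integralT => w; rewrite lee_fin.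
  by rewrite mulr_ge0 ?expR_ge0// (admissible_ge0 _ af).
by rewrite ler_wpM2l ?expR_ge0.
Qed.

Definition continuation r f x := fine (kac r f x).

Lemma continuationE r f x : 0 <= r -> admissible f -> (continuation r f x)%:E = kac r f x.
Proof. by move=> r0 af; rewrite fineK// kac_fin. Qed.

Lemma le_continuation r f f' x : 0 <= r -> admissible f -> admissible f' -> (forall x, f x <= f' x) ->
  continuation r f x <= continuation r f' x.
Proof. by move=> r0 af af' ff'; rewrite -lee_fin !continuationE// le_kac. Qed.

(** Deciding once more at the intermediate time [s] can only lower the value. *)
Lemma kac_semigroup_le s r f f' x : 0 <= s -> 0 <= r -> admissible f -> admissible f' ->
  (forall y, f' y <= continuation r f y) -> (kac s f' x <= kac (s + r) f x)%E.
Proof.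
move=> s0 r0 af af' ff'; rewrite /kac (markov_kac x s0 r0 af (priorT s0)).
apply: ge0_le_integralT => w.
  by rewrite lee_fin mulr_ge0 ?expR_ge0// (admissible_ge0 _ af').
by rewrite -continuationE// -EFinM lee_fin ler_wpM2l ?expR_ge0.
Qed.

(** * Costs of stopping *)

Lemma admissible_expG : admissible expG.
Proof.
split; first by apply: measurableT_comp => //; exact: measurable_reward.
by move=> x; rewrite lexx andbT -expR0 ler_expR (reward_ge0 HS).
Qed.

Lemma admissible1 : admissible one.
Proof.
split; first exact: measurable_cst.
by move=> x; rewrite lexx/= -expR0 ler_expR (reward_ge0 HS).
Qed.

Definition discounted (t : R) (f : E -> R) (w : Omega) : R := expR (rc t w) * f (X t w).

Lemma discounted_ge0 t f w : admissible f -> 0 <= discounted t f w.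
Proof. by move=> af; rewrite mulr_ge0 ?expR_ge0// (admissible_ge0 _ af). Qed.

Lemma measurable_discounted t f : 0 <= t -> admissible f -> measurable_fun setT (discounted t f).
Proof.
move=> t0 af; apply: measurable_funM; last exact: (measurable_comp_real t0 af.1).
by apply: measurableT_comp => //; exact: measurable_running_cost.
Qed.

Lemma running_cost_mono w s t : 0 <= s -> s <= t -> rc s w <= rc t w.
Proof.
move=> s0 st; have ts0 : 0 <= t - s by rewrite subr_ge0.
have -> : t = s + (t - s) by rewrite addrC subrK.
rewrite running_cost_add// lerDl (le_trans _ (rint_rate_ge w s0 ts0))//.
by rewrite mulr_ge0// ltW// (rate_lower_gt0 HS).
Qed.

Lemma running_cost_right_cvg w r : 0 <= r -> rc s w @[s --> r^'+] --> rc r w.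
Proof.
move=> r0; apply: (@squeeze_cvgr _ _ _ _ (cst (rc r w)) (fun s => rc r w + M * (s - r))).
- near=> s; have rs : r <= s by apply/ltW; near: s; exact: nbhs_right_gt.
  have -> : s = r + (s - r) by rewrite addrC subrK.
  rewrite running_cost_add// ?subr_ge0// lerDl.
  have sr0 : 0 <= s - r by rewrite subr_ge0.
  rewrite (le_trans _ (rint_rate_ge w r0 sr0)); last first.
    by rewrite mulr_ge0// ltW// (rate_lower_gt0 HS).
  by rewrite lerD2l addrAC subrr add0r rint_rate_le.
- exact: cvg_cst.
- rewrite -[X in _ --> X]addr0; apply: cvgD; first exact: cvg_cst.
  rewrite -(mulr0 M); apply: cvgM; first exact: cvg_cst.
  apply: cvg_at_right_filter; rewrite -(subrr r); apply: cvgB => //; exact: cvg_cst.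
Unshelve. all: by end_near. Qed.

Lemma discounted_reward_right_cvg w r : 0 <= r ->
  discounted s expG w @[s --> r^'+] --> discounted r expG w.
Proof.
move=> r0; apply: cvgM.
  by apply: continuous_cvg; [exact: continuous_expR|exact: running_cost_right_cvg].
apply: continuous_cvg; first exact: continuous_expR.
apply: (cvg_comp (X ^~ w) G (state_right_cvg r0)).
exact: (reward_continuous HS).
Qed.

(** Stopping at [tau] with a deadline [T] at which [p] is paid instead of the
exponential of [G]. For [p] the exponential of [v] this is the cost in the
Bellman equation; for [p = 1] nothing is paid at the deadline beyond the running
cost. *)
Definition cost (p : E -> R) (T : R) (tau : Omega -> \bar R) w : R :=
  let r := fine (Order.min (tau w) T%:E) in
  expR (rc r w) * (if (tau w < T%:E)%E then expR (G (X r w)) else p (X T w)).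

Lemma cost_le p p' T tau w : (forall x, p x <= p' x) -> cost p T tau w <= cost p' T tau w.
Proof. by move=> pp'; rewrite /cost /= ler_wpM2l ?expR_ge0//; case: ifP. Qed.

Lemma cost_ge0 p T tau w : admissible p -> 0 <= cost p T tau w.
Proof.
by move=> ap; rewrite mulr_ge0 ?expR_ge0//; case: ifP => _; rewrite ?expR_ge0// (admissible_ge0 _ ap).
Qed.

Lemma integral_cost_le p p' T tau x : admissible p -> (forall x, p x <= p' x) ->
  (\int[P x]_w (cost p T tau w)%:E <= \int[P x]_w (cost p' T tau w)%:E)%E.
Proof.
move=> ap pp'; apply: ge0_le_integralT => w; rewrite lee_fin; first exact: cost_ge0.
exact: cost_le.
Qed.

(** A deadline without terminal reward interrupts an increasing running cost. *)
Lemma cost_le_stop_cost T tau w : 0 <= T -> (0 <= tau w)%E ->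
  ((cost one T tau w)%:E <= stop_cost X G g tau w)%E.
Proof.
move=> T0; rewrite /cost /stop_cost; case: (tau w) => [r| |] //= r0; last exact: leey.
rewrite lte_fin lee_fin expRD; have [rT|Tr] := ltP r T.
  by rewrite min_l// lee_fin ltW.
have -> : Order.min r%:E T%:E = T%:E by apply/min_idPr; rewrite lee_fin.
apply: ler_pM; [exact: expR_ge0|exact: ler01|by rewrite ler_expR; exact: running_cost_mono|].
by rewrite -expR0 ler_expR (reward_ge0 HS).
Qed.

Lemma stopping_time_cst (t : R) : 0 <= t -> stopping_time F (cst t%:E).
Proof.
move=> t0; split=> [w|s s0 /=]; first by rewrite lee_fin.
have [ts|st] := leP t s.
  rewrite (_ : [set _ | _] = setT); first exact: (priorT s0).
  by apply/seteqP; split => // w _ /=; rewrite lee_fin.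
rewrite (_ : [set _ | _] = set0).
  rewrite -(filtrationE s0); exact: (@measurable0 _ (g_sigma_algebraType (F s))).
by apply/seteqP; split => // w /=; rewrite lee_fin leNgt st.
Qed.

Lemma stopping_time_min tau (t : R) : stopping_time F tau -> 0 <= t ->
  stopping_time F (fun w => mine (tau w) t%:E).
Proof.
move=> st t0; split=> [w|s s0]; first by rewrite le_min st.1 lee_fin.
rewrite (_ : [set _ | _] = [set w | (tau w <= s%:E)%E] `|` [set w | (cst t%:E w <= s%:E)%E]).
  by apply: priorU => //; [exact: st.2|exact: (stopping_time_cst t0).2].
by apply/seteqP; split => w /=; rewrite ge_min => /orP.
Qed.

(** The infimum is at most [t] when for every [u > t] some member is at most [u];
the right-continuity of the filtration brings this event back from the times
[u] to [t]. *)
Lemma stopping_time_inf (rho_ : nat -> Omega -> \bar R) :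
  (forall k, stopping_time F (rho_ k)) ->
  stopping_time F (fun w => ereal_inf (range (rho_ ^~ w))).
Proof.
move=> st; split=> [w|t t0].
  by apply: le_ereal_inf_tmp => _ [k _ <-]; exact: (st k).1.
apply: (filtration_right HF t0) => s /= ts; have s0 : 0 <= s by exact: le_trans (ltW ts).
(* times in ]t, s] that decrease to t *)
pose u m := t + (s - t) / m.+1%:R.
have ut m : t < u m by rewrite ltrDl divr_gt0// subr_gt0.
have us m : u m <= s.
  rewrite -lerBrDl ler_pdivrMr// ler_peMr ?ler1n// subr_ge0 ltW//.
rewrite (_ : [set _ | _] = \bigcap_m \bigcup_k [set w | (rho_ k w <= (u m)%:E)%E]).
  rewrite -(filtrationE s0).
  apply: (@bigcapT_measurable _ (g_sigma_algebraType (F s))) => m.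
  apply: (@bigcupT_measurable _ (g_sigma_algebraType (F s))) => k.
  change (<<s F s >> [set w | (rho_ k w <= (u m)%:E)%E]); rewrite (filtrationE s0).
  apply: (filtration_mono HF (s := u m)); last by apply: (st k).2; rewrite ltW// (le_lt_trans t0).
  by rewrite us ltW// (le_lt_trans t0).
apply/seteqP; split => [w /= rt m _|w H /=].
  have : (ereal_inf (range (rho_ ^~ w)) < (u m)%:E)%E by rewrite (le_lt_trans rt)// lte_fin.
  by move=> /ereal_inf_lt[_ [k _ <-] /ltW ku]; exists k.
have le_u m : (ereal_inf (range (rho_ ^~ w)) <= (u m)%:E)%E.
  by have [k _ /= ku] := H m I; apply: le_trans ku; apply: ereal_inf_lbound; exists k.
have cu : (u m)%:E @[m --> \oo] --> t%:E.
  apply/cvg_EFin; first exact: nearW.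
  rewrite -[X in _ --> X]addr0; apply: cvgD; first exact: cvg_cst.
  by rewrite -(mulr0 (s - t)); apply: cvgM; [exact: cvg_cst|exact: cvg_harmonic].
rewrite -(cvg_lim _ cu)//; apply: lime_ge; first by apply/cvg_ex; eexists; exact: cu.
exact: nearW.
Qed.

(** * Dyadic grids *)

Section grid.
Variable b : R.
Hypothesis b_gt0 : 0 < b.

(** The time unit [b] is kept arbitrary; deadlines are its multiples. *)
Definition mesh n : R := b / (2 ^ n)%:R.
Definition grid n j : R := j%:R * mesh n.

Lemma mesh_gt0 n : 0 < mesh n.
Proof. by rewrite divr_gt0// ltr0n expn_gt0. Qed.

Lemma mesh_ge0 n : 0 <= mesh n. Proof. exact/ltW/mesh_gt0. Qed.

Lemma meshS n : mesh n = mesh n.+1 + mesh n.+1.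
Proof. by rewrite /mesh expnS natrM invfM; field; rewrite pnatr_eq0 expn_eq0. Qed.

Lemma grid_ge0 n j : 0 <= grid n j.
Proof. by rewrite mulr_ge0// mesh_ge0. Qed.

Lemma gridS n j : grid n j.+1 = grid n j + mesh n.
Proof. by rewrite /grid -natr1 mulrDl mul1r. Qed.

Lemma grid_refine n m j : grid (n + m) (j * 2 ^ m) = grid n j.
Proof.
rewrite /grid /mesh natrM expnD natrM invfM; field.
by rewrite !pnatr_eq0 !expn_eq0.
Qed.

Lemma grid_base n k : grid n (k * 2 ^ n) = k%:R * b.
Proof. by rewrite -[n in grid n]add0n grid_refine /grid /mesh expn0 divr1. Qed.

Lemma le_grid n i j : (i <= j)%N -> grid n i <= grid n j.
Proof. by move=> ij; rewrite ler_wpM2r ?mesh_ge0// ler_nat. Qed.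

(** Stopping times with values on a grid are represented by their indices. *)
Definition grid_stopping n (N : Omega -> nat) :=
  forall j, F (grid n j) [set w | (N w <= j)%N].

Lemma measurable_grid_stopping n N j : grid_stopping n N -> measurable [set w | N w = j].
Proof.
move=> sN; have m i : measurable [set w | (N w <= i)%N].
  by apply: (filtration_sub HF (grid_ge0 n i)); exact: sN.
rewrite (_ : [set _ | _] = [set w | (N w <= j)%N] `\` [set w | (N w < j)%N]).
  apply: measurableD => //; case: j => [|j]; last exact: m.
  by rewrite (_ : [set _ | _] = set0)//; apply/seteqP; split.
apply/seteqP; split => [w /= ->|w /= [Nj /negP]]; first by rewrite ltnn.
by rewrite -leqNgt => jN; apply/eqP; rewrite eqn_leq Nj.
Qed.

Lemma hit_stopping n K (p : nat -> Omega -> bool) :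
  (forall j, (j < K)%N -> F (grid n j) [set w | p j w]) ->
  grid_stopping n (hit K p).
Proof.
move=> Fp j; have [jK|Kj] := ltnP j K; last first.
  rewrite (_ : [set _ | _] = setT); first exact: (priorT (grid_ge0 n j)).
  by apply/seteqP; split => // w _ /=; exact: leq_trans (hit_le _ _ _) Kj.
rewrite (_ : [set _ | _] = \bigcup_(i in `I_j.+1) [set w | p i w]); last first.
  apply/seteqP; split => w /=; rewrite hit_le_ex//.
    by move=> /existsP[i pi]; exists i => //=.
  by move=> [i /= ij pi]; apply/existsP; exists (Ordinal ij).
rewrite -(filtrationE (grid_ge0 n j)).
apply: (@bigcup_measurable _ (Ft (grid n j))) => i /= ij.
change (<<s F (grid n j) >> [set w | p i w]); rewrite (filtrationE (grid_ge0 n j)).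
apply: (filtration_mono HF (s := grid n i)); first by rewrite grid_ge0 le_grid.
by apply: Fp; exact: leq_ltn_trans jK.
Qed.

Lemma grid_stopping_refine n m N : grid_stopping n N -> grid_stopping (n + m) (fun w => N w * 2 ^ m)%N.
Proof.
move=> sN j; rewrite (_ : [set _ | _] = [set w | (N w <= j %/ 2 ^ m)%N]); last first.
  by apply/seteqP; split => w /=; rewrite leq_divRL// expn_gt0.
apply: (filtration_mono HF (s := grid n (j %/ 2 ^ m))); last exact: sN.
by rewrite grid_ge0 -(grid_refine n m)// le_grid// leq_divM.
Qed.

Lemma grid_stopping_minn n N1 N2 : grid_stopping n N1 -> grid_stopping n N2 ->
  grid_stopping n (fun w => minn (N1 w) (N2 w)).
Proof.
move=> s1 s2 j; rewrite (_ : [set _ | _] = [set w | (N1 w <= j)%N] `|` [set w | (N2 w <= j)%N]).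
  by apply: priorU; [exact: grid_ge0|exact: s1|exact: s2].
apply/seteqP; split => w /=; rewrite geq_min; first by move=> /orP.
by move=> H; apply/orP.
Qed.

Let grid_reward (T : R) (k : nat) (w : Omega) : \bar R :=
  if @choice.unpickle (nat * nat)%type k is Some nj then
    if grid nj.1 nj.2 <= T then (expR (G (X (grid nj.1 nj.2) w)))%:E else 0%E
  else 0%E.

(** The supremum runs over dyadic times only, which makes it measurable; it bounds
the cost of every strategy that stops on some dyadic grid before [T]. *)
Definition dominator (T : R) (w : Omega) : \bar R :=
  ((expR (M * T))%:E * esups (grid_reward T ^~ w) 0%N)%E.

Lemma measurable_dominator T : measurable_fun setT (dominator T).
Proof.
apply: measurable_funeM; apply: measurable_fun_esups => k; rewrite /grid_reward.
case: choice.unpickle => [[n j]|] //=; case: (_ <= T) => //.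
by apply: measurable_reward_state; exact: grid_ge0.
Qed.

Lemma dominator_ge T n j f w : admissible f -> grid n j <= T ->
  ((discounted (grid n j) f w)%:E <= dominator T w)%E.
Proof.
move=> af jT; rewrite /discounted EFinM; apply: lee_pmul.
- by rewrite lee_fin expR_ge0.
- by rewrite lee_fin (admissible_ge0 _ af).
- rewrite lee_fin ler_expR (le_trans (running_cost_le w (grid_ge0 n j)))//.
  rewrite ler_wpM2l//; exact: le_trans (rate_ge0 point) (rate_upper HS point).
apply: (@le_trans _ _ (expR (G (X (grid n j) w)))%:E).
  by rewrite lee_fin; case/andP: (af.2 (X (grid n j) w)).
apply: ereal_sup_ubound; exists (choice.pickle (n, j)) => //.
by rewrite /grid_reward choice.pickleK/= jT.
Qed.

Lemma dominator_integrable T x : 0 <= T -> (\int[P x]_w dominator T w < +oo)%E.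
Proof.
move=> T0; pose S w := ereal_sup [set (expR (G (X t w)))%:E | t in `[0, T]%classic].
have gr0 k w : (0 <= grid_reward T k w)%E.
  rewrite /grid_reward; case: choice.unpickle => [[n j]|] //=; case: ifP => // _.
have es0 w : (0 <= esups (grid_reward T ^~ w) 0%N)%E.
  by apply: le_trans (gr0 0%N w) _; apply: ereal_sup_ubound; exists 0%N.
rewrite ge0_integralZl_EFin ?expR_ge0//; last first.
  apply: measurable_fun_esups => k; rewrite /grid_reward.
  case: choice.unpickle => [[n j]|] //=; case: (_ <= T) => //.
  by apply: measurable_reward_state; exact: grid_ge0.
apply: lte_mul_pinfty; rewrite ?lee_fin ?expR_ge0//.
apply: le_lt_trans (reward_sup_integrable HS x T0).
apply: ge0_le_integralT => w //; apply: ub_ereal_sup => _ [k _ <-].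
have S0 : (0 <= S w)%E.
  apply: (@le_trans _ _ (expR (G (X 0 w)))%:E) => //.
  by apply: ereal_sup_ubound; exists 0 => //=; rewrite in_itv/= lexx.
rewrite /grid_reward; case: choice.unpickle => [[n j]|] //=; case: ifP => // jT.
apply: ereal_sup_ubound; exists (grid n j) => //=.
by rewrite in_itv/= grid_ge0.
Qed.

(** The cost of stopping at the grid point of index [N], with the deadline at
index [i]. *)
Definition grid_cost n i (p : E -> R) (N : Omega -> nat) w :=
  if (N w < i)%N then discounted (grid n (N w)) expG w else discounted (grid n i) p w.

(** [tau] rounded up to the grid; rounding up preserves stopping times. *)
Definition ceil_index n K (tau : Omega -> \bar R) :=
  hit K (fun j w => (tau w <= (grid n j)%:E)%E).

Lemma grid_cost_le_dominator n i p N T w : admissible p -> grid n i <= T ->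
  ((grid_cost n i p N w)%:E <= dominator T w)%E.
Proof.
move=> ap iT; rewrite /grid_cost; case: ifP => Ni; last exact: dominator_ge.
apply: dominator_ge; first exact: admissible_expG.
by apply: le_trans iT; apply: le_grid; exact: ltnW.
Qed.

Lemma grid_cost_ge0 n i p N w : admissible p -> 0 <= grid_cost n i p N w.
Proof.
move=> ap; rewrite /grid_cost; case: ifP => _; last exact: (discounted_ge0 _ _ ap).
exact: (discounted_ge0 _ _ admissible_expG).
Qed.

Lemma measurable_grid_cost n i p N : admissible p -> grid_stopping n N ->
  measurable_fun setT (grid_cost n i p N).
Proof.
move=> ap sN; apply: (measurable_select (f :=
  fun k w => if (k < i)%N then discounted (grid n k) expG w else discounted (grid n i) p w)).
  move=> j; case: (j < i)%N; apply: measurable_discounted => //;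
    [exact: grid_ge0|exact: admissible_expG|exact: grid_ge0].
by move=> j; exact: (measurable_grid_stopping _ sN).
Qed.

Lemma ceil_index_stopping n K tau : stopping_time F tau ->
  grid_stopping n (ceil_index n K tau).
Proof.
move=> [_ st]; apply: hit_stopping => j _; apply: st; exact: grid_ge0.
Qed.

Lemma grid_cost_cap n K i p tau w : (i <= K)%N ->
  grid_cost n i p (ceil_index n i tau) w = grid_cost n i p (ceil_index n K tau) w.
Proof.
move=> iK; rewrite /grid_cost /ceil_index (hit_minn _ _ iK).
by rewrite gtn_min ltnn orbF; case: ltnP => // /ltnW/minn_idPl ->.
Qed.

(** The rounded times approach [tau] from the right, and the paths, hence the
costs, are right-continuous. At or after the deadline the rounded index is the
last one on every grid. *)
Lemma grid_cost_cvg k (p_ : nat -> E -> R) p tau w :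
  (0 <= tau w)%E -> (forall x, p_ n x @[n --> \oo] --> p x) ->
  grid_cost n (k * 2 ^ n) (p_ n) (ceil_index n (k * 2 ^ n) tau) w @[n --> \oo] -->
  cost p (k%:R * b) tau w.
Proof.
move=> tau0 p_p; set T := k%:R * b.
have gT n : grid n (k * 2 ^ n) = T by exact: grid_base.
rewrite /cost /=; have [tauT|Ttau] := ltP (tau w) T%:E; last first.
  rewrite /=.
  have hitK n : ceil_index n (k * 2 ^ n) tau w = (k * 2 ^ n)%N.
    apply/eqP; rewrite eqn_leq hit_le leqNgt; apply/negP => hK.
    have := hit_holds hK; apply/negP; rewrite -ltNge (lt_le_trans _ Ttau)//.
    by rewrite lte_fin -(gT n) ltr_pM2r ?mesh_gt0// ltr_nat.
  rewrite (_ : (fun n => _) = fun n => expR (rc T w) * p_ n (X T w)).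
    by apply: cvgM; [exact: cvg_cst|exact: p_p].
  by apply/funext => n; rewrite /grid_cost hitK ltnn gT.
have tau_fin : tau w \is a fin_num by rewrite ge0_fin_numE// (lt_trans tauT)// ltry.
set r := fine (tau w); have tauE : tau w = r%:E by rewrite fineK.
have r0 : 0 <= r by rewrite -lee_fin -tauE.
have rT : r < T by rewrite -lte_fin -tauE.
pose N n := ceil_index n (k * 2 ^ n) tau w.
have rN n : r <= grid n (N n).
  have [NK|] := ltnP (N n) (k * 2 ^ n)%N.
    by have := hit_holds NK; rewrite tauE lee_fin.
  by move=> KN; apply: (le_trans (ltW rT)); rewrite -(gT n) le_grid.
have Nr n : grid n (N n) <= r + mesh n.
  case EN : (N n) => [|j]; first by rewrite /grid mul0r addr_ge0// mesh_ge0.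
  have jN : (j < N n)%N by rewrite EN.
  have := hit_before jN; rewrite tauE lee_fin -ltNge => jr.
  by rewrite gridS lerD2r ltW.
have mesh0 : mesh n @[n --> \oo] --> (0 : R).
  rewrite (_ : mesh = (fun n => b * (2^-1) ^+ n)); last first.
    by apply/funext => n; rewrite /mesh natrX exprVn.
  rewrite -(mulr0 b); apply: cvgM; first exact: cvg_cst.
  by apply: cvg_expr; rewrite ger0_norm ?invr_ge0// invf_lt1// ltr1n.
have gN : grid n (N n) @[n --> \oo] --> r.
  apply: (@squeeze_cvgr _ _ _ _ (cst r) (fun n => r + mesh n)).
  - by apply: nearW => n; rewrite rN Nr.
  - exact: cvg_cst.
  - by rewrite -[X in _ --> X]addr0; apply: cvgD; [exact: cvg_cst|exact: mesh0].
have cN : discounted (grid n (N n)) expG w @[n --> \oo] --> discounted r expG w.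
  apply: (@cvg_from_right _ _ (fun s => discounted s expG w)) => //.
  exact: discounted_reward_right_cvg.
apply: cvg_trans cN; apply: near_eq_cvg.
have /cvgr_lt : grid n (N n) @[n --> \oo] --> r := gN.
move=> /(_ T rT); apply: filterS => n NT.
rewrite /grid_cost -/(N n); case: ltnP => // KN.
by move: NT; rewrite ltNge -(gT n) le_grid.
Qed.

Lemma measurable_cost k p tau : admissible p -> stopping_time F tau ->
  measurable_fun setT (cost p (k%:R * b) tau).
Proof.
move=> ap st; apply: (measurable_fun_cvg
  (fun n => @measurable_grid_cost n (k * 2 ^ n)%N p _ ap (ceil_index_stopping n (k * 2 ^ n)%N st))).
by move=> w _; apply: grid_cost_cvg => [|x]; [exact: st.1|exact: cvg_cst].
Qed.

Lemma integral_grid_cost_cvg k (p_ : nat -> E -> R) p tau x :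
  (forall n, admissible (p_ n)) -> admissible p ->
  stopping_time F tau -> (forall x, p_ n x @[n --> \oo] --> p x) ->
  (\int[P x]_w (grid_cost n (k * 2 ^ n) (p_ n) (ceil_index n (k * 2 ^ n) tau) w)%:E @[n --> \oo] -->
  \int[P x]_w (cost p (k%:R * b) tau w)%:E)%E.
Proof.
move=> ap_ ap st p_p; apply: (ge0_dominated_cvg (h := dominator (k%:R * b))) => //.
- by move=> n; apply: measurable_grid_cost => //; exact: ceil_index_stopping.
- by move=> w _; apply: grid_cost_cvg => //; exact: st.1.
- exact: measurable_cost.
- by move=> n w; exact: grid_cost_ge0.
- by move=> n w; apply: grid_cost_le_dominator; rewrite ?grid_base.
- exact: measurable_dominator.
- by apply: dominator_integrable; rewrite mulr_ge0// ltW.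
Qed.

(** The index [K] stands for the absence of stopping before the deadline, hence
for an infinite time. *)
Definition index_time n K (N : Omega -> nat) (w : Omega) : \bar R :=
  if (N w < K)%N then (grid n (N w))%:E else +oo%E.

Lemma index_time_stopping n K N : grid_stopping n N -> stopping_time F (index_time n K N).
Proof.
move=> sN; split=> [w|t t0].
  by rewrite /index_time; case: ifP => // _; rewrite lee_fin grid_ge0.
rewrite (_ : [set _ | _] = \bigcup_(j in [set j | (j < K)%N /\ grid n j <= t])
    [set w | (N w <= j)%N]).
  rewrite -(filtrationE t0); apply: (@bigcup_measurable _ (g_sigma_algebraType (F t))) => j [jK jt].
  change (<<s F t >> [set w | (N w <= j)%N]); rewrite (filtrationE t0).
  by apply: (filtration_mono HF (s := grid n j)) (sN j); rewrite grid_ge0.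
apply/seteqP; split => [w /=|w [j [jK jt] /= Nj]]; rewrite /index_time.
  case: ltnP => // NK; rewrite ?leye_eq// lee_fin => Nt.
  by exists (N w) => /=.
by rewrite (leq_ltn_trans Nj jK) lee_fin (le_trans _ jt)// le_grid.
Qed.

Lemma index_time_cost n K N p w :
  cost p (grid n K) (index_time n K N) w = grid_cost n K p N w.
Proof.
rewrite /cost /index_time /grid_cost; case: ltnP => NK /=.
  have lt : ((grid n (N w))%:E < (grid n K)%:E)%E.
    by rewrite lte_fin ltr_pM2r ?mesh_gt0// ltr_nat.
  by rewrite min_l ?ltW// lt.
by [].
Qed.

(** On the event that [tau] is infinite the limit is infinite because the rate is
at least [c > 0]. *)
Lemma stop_cost_cvg tau w : (0 <= tau w)%E ->
  (cost one (k%:R * b) tau w)%:E @[k --> \oo] --> stop_cost X G g tau w.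
Proof.
rewrite /cost /stop_cost; case: (tau w) => [r| |] //= r0.
  apply: cvg_near_cst; near=> k.
  have rk : r < k%:R * b by rewrite -ltr_pdivrMr//; near: k; exact: nbhs_infty_gtr.
  by rewrite lte_fin rk min_l ?lee_fin ?ltW//= expRD.
apply/cvgeryP/cvgryPge => A; near=> k.
have kb0 : 0 <= k%:R * b by rewrite mulr_ge0// ltW.
rewrite /= mulr1 (le_trans _ (expR_ge1Dx _))//.
rewrite ler_wpDl// (le_trans _ (running_cost_ge w kb0))//.
rewrite mulrCA -ler_pdivrMr ?mulr_gt0// ?(rate_lower_gt0 HS)//.
by near: k; exact: nbhs_infty_ger.
Unshelve. all: by end_near. Qed.

Lemma measurable_stop_cost tau : stopping_time F tau ->
  measurable_fun setT (stop_cost X G g tau).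
Proof.
move=> st; apply: (emeasurable_fun_cvg
  (fun k w => (cost one (k%:R * b) tau w)%:E)).
  by move=> k; apply/measurable_EFinP; exact: (measurable_cost k admissible1 st).
by move=> w _; apply: stop_cost_cvg; exact: st.1.
Qed.

Lemma cost_integrable tau x : stopping_time F tau ->
  (\int[P x]_w (cost expG b tau w)%:E < +oo)%E.
Proof.
move=> st; have ae := admissible_expG.
have cst_e y : (fun _ : nat => expR (G y)) @ \oo --> expR (G y) by exact: cvg_cst.
have := @integral_grid_cost_cvg 1
  (fun=> expG) _ _ x (fun=> ae) ae st cst_e.
rewrite mul1r => cv; rewrite -(cvg_lim _ cv)//.
apply: le_lt_trans (dominator_integrable x (ltW b_gt0)).
apply: lime_le; first by apply/cvg_ex; eexists; exact: cv.
apply: nearW => n; apply: ge0_le_integralT => w; first by rewrite lee_fin grid_cost_ge0.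
by apply: grid_cost_le_dominator => //; rewrite grid_base mul1r.
Qed.

Lemma integral_cost_cvg (p_ : nat -> E -> R) p tau x :
  (forall n, admissible (p_ n)) -> admissible p -> stopping_time F tau ->
  (forall y, p_ n y @[n --> \oo] --> p y) ->
  (\int[P x]_w (cost (p_ n) b tau w)%:E @[n --> \oo] -->
   \int[P x]_w (cost p b tau w)%:E)%E.
Proof.
move=> ap_ ap st cp.
have mc p' : admissible p' -> measurable_fun setT (cost p' b tau).
  by move=> ap'; rewrite -[b in cost _ b]mul1r; exact: (measurable_cost 1 ap' st).
apply: (ge0_dominated_cvg (h := fun w => (cost expG b tau w)%:E)) => //.
- by move=> n; exact: mc.
- move=> w _; rewrite /cost /=; apply: cvgM; first exact: cvg_cst.
  by case: ifP => _; [exact: cvg_cst|exact: cp].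
- exact: mc.
- by move=> n w; exact: cost_ge0.
- by move=> n w; rewrite lee_fin; apply: cost_le => y; case/andP: ((ap_ n).2 y).
- by apply/measurable_EFinP; apply: mc; exact: admissible_expG.
- exact: cost_integrable.
Qed.

(** * Backward induction on a grid *)

Section backward_induction.
Variable q : E -> R.
Hypothesis q_adm : admissible q.

(** Backward induction: the optimal cost on the grid of mesh [b / 2 ^ n] with [j]
steps to go and terminal reward [q]. *)
Fixpoint grid_value n j : E -> R :=
  if j is j'.+1 then fun x => Num.min (expR (G x)) (continuation (mesh n) (grid_value n j') x)
  else q.

Lemma admissible_grid_value n j : admissible (grid_value n j).
Proof.
elim: j => [//|j IH] /=; split=> [|x].
  apply: measurable_minr.
    by apply: measurableT_comp => //; exact: measurable_reward.
  apply: measurableT_comp => //; exact: (measurable_kac (mesh_ge0 n) IH).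
rewrite ge_min lexx andbT le_min; apply/andP; split.
  by rewrite -expR0 ler_expR (reward_ge0 HS).
by rewrite -lee_fin continuationE ?mesh_ge0// kac_ge1// mesh_ge0.
Qed.

Lemma grid_value_le n j x : grid_value n j x <= expR (G x).
Proof. by case/andP: ((admissible_grid_value n j).2 x). Qed.

Lemma grid_value_ge1 n j x : 1 <= grid_value n j x.
Proof. by case/andP: ((admissible_grid_value n j).2 x). Qed.

(** The finer grid contains the coarser one, so it offers more decisions. *)
Lemma grid_value_refine n j x : grid_value n.+1 (j * 2) x <= grid_value n j x.
Proof.
elim: j x => [|j IH] x /=; first by [].
rewrite le_min; apply/andP; split; first exact: (grid_value_le _ (j.+1 * 2)).
rewrite ge_min; apply/orP; right.
have aj := admissible_grid_value n.+1 (j * 2).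
rewrite -lee_fin !continuationE ?mesh_ge0//; last exact: (admissible_grid_value _ (j * 2).+1).
  apply: (@le_trans _ _ (kac (mesh n) (grid_value n.+1 (j * 2)) x)); last exact: le_kac.
  rewrite [in leRHS]meshS; apply: kac_semigroup_le; rewrite ?mesh_ge0//.
    exact: (admissible_grid_value _ (j * 2).+1).
  by move=> y; rewrite ge_min lexx orbT.
exact: admissible_grid_value.
Qed.

Lemma grid_value_refine_iter n m j x : grid_value (n + m).+1 (j * 2 ^ m.+1) x <= grid_value (n + m) (j * 2 ^ m) x.
Proof. by rewrite expnSr mulnA; exact: grid_value_refine. Qed.

Lemma grid_value_refine_nonincreasing n j x :
  nonincreasing_seq (fun m => grid_value (n + m) (j * 2 ^ m) x).
Proof. by apply/nonincreasing_seqP => m; rewrite addnS; exact: grid_value_refine_iter. Qed.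

(** The limit over finer and finer grids at the fixed remaining time [grid n j]. *)
Definition refined_value n j x := limn (fun m => grid_value (n + m) (j * 2 ^ m) x).

Lemma refined_value_cvg n j x : grid_value (n + m) (j * 2 ^ m) x @[m --> \oo] --> refined_value n j x.
Proof.
apply: nonincreasing_is_cvgn; first exact: grid_value_refine_nonincreasing.
by exists 1 => _ [m _ <-]; exact: grid_value_ge1.
Qed.

Arguments refined_value_cvg : clear implicits.

Lemma refined_value_le_grid_value n j x m : refined_value n j x <= grid_value (n + m) (j * 2 ^ m) x.
Proof.
apply: nonincreasing_cvgn_ge; first exact: grid_value_refine_nonincreasing.
by apply/cvg_ex; eexists; exact: refined_value_cvg.
Qed.

Lemma admissible_refined_value n j : admissible (refined_value n j).
Proof.
split.
  apply: (@measurable_fun_cvg _ (borel E) _ _ (fun m => grid_value (n + m) (j * 2 ^ m))).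
    by move=> m; exact: (admissible_grid_value _ _).1.
  by move=> x _; exact: refined_value_cvg.
move=> x; apply/andP; split; last first.
  by apply: le_trans (refined_value_le_grid_value n j x 0) (grid_value_le _ _ _).
apply: limr_ge; first by apply/cvg_ex; eexists; exact: refined_value_cvg.
by apply: nearW => m; exact: grid_value_ge1.
Qed.

(** The limit depends only on the remaining time, not on the grid that expresses
it: this is what makes thresholds defined by it comparable between grids. *)
Lemma refined_value_refine n m j : refined_value (n + m) (j * 2 ^ m) = refined_value n j.
Proof.
apply/funext => x; apply: cvg_lim => //.
rewrite (_ : (fun k => _) = (fun k => grid_value (n + (k + m)) (j * 2 ^ (k + m)) x)); last first.
  by apply/funext => k; rewrite -mulnA -expnD -addnA [in LHS](addnC m).
by rewrite (cvg_shiftn m (fun k => grid_value (n + k) (j * 2 ^ k) x)); exact: refined_value_cvg.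
Qed.

Section level.
Variables (n K : nat).
Local Notation t_ j := (grid n j).

(** The optimal cost discounted along the path, with the deadline at index [K]. *)
Definition value_process j w := discounted (t_ j) (grid_value n (K - j)) w.

Let value_process_next j x A : (j < K)%N -> F (t_ j) A ->
  (\int[P x]_(w in A) (value_process j.+1 w)%:E =
   \int[P x]_(w in A) (discounted (t_ j)
     (continuation (mesh n) (grid_value n (K - j.+1))) w)%:E)%E.
Proof.
move=> jK FA; have aK := admissible_grid_value n (K - j.+1).
rewrite /value_process /discounted gridS.
rewrite (markov_kac x (grid_ge0 n j) (mesh_ge0 n) aK FA).
apply: eq_integral => w _; rewrite EFinM continuationE//.
exact: mesh_ge0.
Qed.

Let grid_value_stepE j x : (j < K)%N -> grid_value n (K - j) x =
  Num.min (expR (G x)) (continuation (mesh n) (grid_value n (K - j.+1)) x).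
Proof. by move=> jK; rewrite -(subnSK jK). Qed.

(** Submartingale property: continuing for one step is one of the options in the
backward induction. *)
Lemma value_process_le j x A : (j < K)%N -> F (t_ j) A ->
  (\int[P x]_(w in A) (value_process j w)%:E <=
   \int[P x]_(w in A) (value_process j.+1 w)%:E)%E.
Proof.
move=> jK FA; rewrite value_process_next//.
rewrite !(integral_mkcond A); apply: ge0_le_integralT => w.
  apply: erestrict_ge0 => ? _; rewrite lee_fin.
  by apply: discounted_ge0; exact: admissible_grid_value.
rewrite !patchE; case: ifPn => // _; rewrite lee_fin /value_process /discounted.
by rewrite ler_wpM2l ?expR_ge0// grid_value_stepE// ge_min lexx orbT.
Qed.

(** Martingale property as long as stopping is not optimal, since then the minimum
in the backward induction is the continuation value. *)
Lemma value_process_ge j x A : (j < K)%N -> F (t_ j) A ->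
  (forall w, A w -> grid_value n (K - j) (X (t_ j) w) < expR (G (X (t_ j) w))) ->
  (\int[P x]_(w in A) (value_process j.+1 w)%:E <=
   \int[P x]_(w in A) (value_process j w)%:E)%E.
Proof.
move=> jK FA below; rewrite value_process_next//.
rewrite le_eqVlt; apply/orP; left; apply/eqP/eq_integral => w /set_mem Aw.
rewrite /value_process /discounted grid_value_stepE//; congr (_ * _)%:E.
have := below _ Aw; rewrite grid_value_stepE// gt_min ltxx/= => lt.
by apply/esym/min_idPr/ltW.
Qed.

Variables (phi : nat -> Omega -> R) (N : Omega -> nat).
Hypothesis phi_ge0 : forall j w, 0 <= phi j w.
Hypothesis mphi : forall j, measurable_fun setT (phi j).
Hypothesis N_stop : grid_stopping n N.

(** The value process followed up to index [i] and replaced by the payoff [phi]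
once [N] has been reached. Increasing [i] one step at a time is optional
stopping, with [phi] above or below the value process as the case may be. *)
Definition stopped i w := if (N w < i)%N then phi (N w) w else value_process i w.

Lemma measurable_stopped i : measurable_fun setT (stopped i).
Proof.
apply: (measurable_select (f :=
  fun k w => if (k < i)%N then phi k w else value_process i w)).
  move=> j; case: (j < i)%N => //.
  by apply: measurable_discounted; [exact: grid_ge0|exact: admissible_grid_value].
by move=> j; exact: measurable_grid_stopping.
Qed.

Lemma stopped_ge0 i w : 0 <= stopped i w.
Proof.
rewrite /stopped; case: ifP => // _.
by apply: discounted_ge0; exact: admissible_grid_value.
Qed.

Lemma stopped0 x : (\int[P x]_w (stopped 0 w)%:E = (grid_value n K x)%:E)%E.
Proof.
apply: integral_start.
- by move=> w; rewrite lee_fin stopped_ge0.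
- by rewrite lee_fin; apply: le_trans (grid_value_ge1 _ _ _).
- by apply/measurable_EFinP; exact: measurable_stopped.
move=> w Xx; rewrite /stopped /value_process /discounted ltn0 subn0 /grid mul0r.
by rewrite running_cost0 expR0 mul1r Xx.
Qed.

Let split_integral x i (f : Omega -> R) : measurable_fun setT f -> (forall w, 0 <= f w) ->
  (\int[P x]_w (f w)%:E = \int[P x]_(w in [set w | (N w <= i)%N]) (f w)%:E +
   \int[P x]_(w in ~` [set w | (N w <= i)%N]) (f w)%:E)%E.
Proof.
move=> mf f0.
have mA : measurable [set w | (N w <= i)%N].
  by apply: (filtration_sub HF (grid_ge0 n i)); exact: N_stop.
rewrite -ge0_integral_setU//= ?setUv//.
- exact: measurableC.
- exact/measurable_EFinP.
- by move=> w _; rewrite lee_fin.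
- by rewrite disj_set2E setICr.
Qed.

(** On [N <= i] only the index [i] itself makes a difference, where the value is
exchanged for [phi]; on the complement, which is prior to the grid point [i],
the submartingale property applies. *)
Lemma stopped_le1 x i : (i < K)%N ->
  (forall w, (N w < K)%N -> value_process (N w) w <= phi (N w) w) ->
  (\int[P x]_w (stopped i w)%:E <= \int[P x]_w (stopped i.+1 w)%:E)%E.
Proof.
move=> iK phi_ge; rewrite !(split_integral x i)//; try exact: measurable_stopped;
  try exact: stopped_ge0.
apply: leeD.
  rewrite [leLHS]integral_mkcond [leRHS]integral_mkcond; apply: ge0_le_integralT => w.
    by apply: erestrict_ge0 => ? _; rewrite lee_fin stopped_ge0.
  rewrite !patchE; case: ifPn => // /set_mem /= Ni; rewrite lee_fin /stopped ltnS Ni.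
  case: ltnP => // iN; have -> : i = N w by apply/eqP; rewrite eqn_leq iN Ni.
  by apply: phi_ge; exact: leq_ltn_trans iK.
have sE j w : (i <= j <= i.+1)%N -> w \in ~` [set w | (N w <= i)%N] -> stopped j w = value_process j w.
  move=> /andP[ij ji] /set_mem /= /negP; rewrite -ltnNge => iN.
  by rewrite /stopped ltnNge (leq_trans ji iN).
rewrite (eq_integral (fun w => (value_process i w)%:E)); last first.
  by move=> w wA; rewrite sE// leqnn leqnSn.
rewrite [leRHS](eq_integral (fun w => (value_process i.+1 w)%:E)); last first.
  by move=> w wA; rewrite sE// leqnn leqnSn.
apply: value_process_le => //; apply: priorC; last exact: N_stop.
exact: grid_ge0.
Qed.

Lemma stopped_ge1 x i : (i < K)%N ->
  (forall w, (N w < K)%N -> phi (N w) w <= value_process (N w) w) ->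
  (forall w j, (j < N w)%N -> (j < K)%N ->
     grid_value n (K - j) (X (t_ j) w) < expR (G (X (t_ j) w))) ->
  (\int[P x]_w (stopped i.+1 w)%:E <= \int[P x]_w (stopped i w)%:E)%E.
Proof.
move=> iK phi_le before; rewrite !(split_integral x i)//; try exact: measurable_stopped;
  try exact: stopped_ge0.
apply: leeD.
  rewrite [leLHS]integral_mkcond [leRHS]integral_mkcond; apply: ge0_le_integralT => w.
    by apply: erestrict_ge0 => ? _; rewrite lee_fin stopped_ge0.
  rewrite !patchE; case: ifPn => // /set_mem /= Ni; rewrite lee_fin /stopped ltnS Ni.
  case: ltnP => // iN; have -> : i = N w by apply/eqP; rewrite eqn_leq iN Ni.
  by apply: phi_le; exact: leq_ltn_trans iK.
have sE j w : (i <= j <= i.+1)%N -> w \in ~` [set w | (N w <= i)%N] -> stopped j w = value_process j w.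
  move=> /andP[ij ji] /set_mem /= /negP; rewrite -ltnNge => iN.
  by rewrite /stopped ltnNge (leq_trans ji iN).
rewrite (eq_integral (fun w => (value_process i.+1 w)%:E)); last first.
  by move=> w wA; rewrite sE// leqnn leqnSn.
rewrite [leRHS](eq_integral (fun w => (value_process i w)%:E)); last first.
  by move=> w wA; rewrite sE// leqnn leqnSn.
apply: value_process_ge => //.
  by apply: priorC; [exact: grid_ge0|exact: N_stop].
by move=> w /= /negP; rewrite -ltnNge => iN; exact: before.
Qed.

Lemma stopped_le x i j : (i <= j <= K)%N ->
  (forall w, (N w < K)%N -> value_process (N w) w <= phi (N w) w) ->
  (\int[P x]_w (stopped i w)%:E <= \int[P x]_w (stopped j w)%:E)%E.
Proof.
move=> /andP[ij jK] phi_ge; elim: j ij jK => [|j IH].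
  by rewrite leqn0 => /eqP ->.
rewrite leq_eqVlt => /predU1P[-> //|ij] jK.
by apply: (le_trans (IH ij (ltnW jK))); exact: stopped_le1.
Qed.

Lemma stopped_ge x i j : (i <= j <= K)%N ->
  (forall w, (N w < K)%N -> phi (N w) w <= value_process (N w) w) ->
  (forall w j, (j < N w)%N -> (j < K)%N ->
     grid_value n (K - j) (X (t_ j) w) < expR (G (X (t_ j) w))) ->
  (\int[P x]_w (stopped j w)%:E <= \int[P x]_w (stopped i w)%:E)%E.
Proof.
move=> /andP[ij jK] phi_le before; elim: j ij jK => [|j IH].
  by rewrite leqn0 => /eqP ->.
rewrite leq_eqVlt => /predU1P[-> //|ij] jK.
by apply: (le_trans _ (IH ij (ltnW jK))); exact: stopped_ge1.
Qed.

End level.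

Definition reward_process n j w := discounted (grid n j) expG w.

Lemma reward_process_ge0 n j w : 0 <= reward_process n j w.
Proof. exact: (discounted_ge0 _ _ admissible_expG). Qed.

Lemma measurable_reward_process n j : measurable_fun setT (reward_process n j).
Proof.
apply: measurable_discounted; [exact: grid_ge0|exact: admissible_expG].
Qed.

Lemma value_process_le_reward n K j w : value_process n K j w <= reward_process n j w.
Proof. by apply: ler_wpM2l; [exact: expR_ge0|exact: grid_value_le]. Qed.

(** Stopping pays the exponential of [G], which is above the value, so following
an arbitrary strategy longer before assuming optimal behaviour costs more. *)
Lemma grid_cost_le x n K i j N : grid_stopping n N -> (i <= j <= K)%N ->
  (\int[P x]_w (grid_cost n i (grid_value n (K - i)) N w)%:E <=
   \int[P x]_w (grid_cost n j (grid_value n (K - j)) N w)%:E)%E.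
Proof.
move=> sN ijK.
have := @stopped_le n K _ N
   (reward_process_ge0 n) (measurable_reward_process n) sN x i j ijK.
by apply => w _; exact: value_process_le_reward.
Qed.

Lemma grid_cost0 x n K N : grid_stopping n N ->
  (\int[P x]_w (grid_cost n 0 (grid_value n (K - 0)) N w)%:E = (grid_value n K x)%:E)%E.
Proof.
move=> sN; exact: (@stopped0 n K _ N
   (reward_process_ge0 n) (measurable_reward_process n) sN x).
Qed.

Lemma refined_value_cvg0 k x : grid_value m (k * 2 ^ m) x @[m --> \oo] --> refined_value 0 k x.
Proof. exact: (refined_value_cvg 0 k x). Qed.

Arguments refined_value_cvg0 : clear implicits.

(** Dynamic programming over one unit of time, upper half: round [tau] up to the
grid, behave optimally on the grid after time [b], and refine the grid. *)
Lemma refined_value_le_cost k tau x : stopping_time F tau ->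
  ((refined_value 0 k.+1 x)%:E <= \int[P x]_w (cost (refined_value 0 k) b tau w)%:E)%E.
Proof.
move=> st.
have := @integral_grid_cost_cvg 1
  (fun n => grid_value n (k * 2 ^ n)) _ _ x
  (fun n => admissible_grid_value n (k * 2 ^ n))
  (admissible_refined_value 0 k) st (refined_value_cvg0 k).
rewrite mul1r => cv; rewrite -(cvg_lim _ cv)//.
have cl : (grid_value m (k.+1 * 2 ^ m) x)%:E @[m --> \oo] --> (refined_value 0 k.+1 x)%:E.
  by apply/cvg_EFin; [exact: nearW|exact: refined_value_cvg0].
rewrite -(cvg_lim _ cl)//; apply: lee_lim.
- by apply/cvg_ex; eexists; exact: cl.
- by apply/cvg_ex; eexists; exact: cv.
apply: nearW => n.
have sN := @ceil_index_stopping n (1 * 2 ^ n) _ st.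
rewrite -(grid_cost0 x (k.+1 * 2 ^ n) sN).
have -> : (k * 2 ^ n = k.+1 * 2 ^ n - 1 * 2 ^ n)%N by rewrite -mulnBl subn1.
by apply: grid_cost_le => //; rewrite leq_mul2r orbT.
Qed.

(** Dynamic programming over one unit of time, lower half: after time [b] no
strategy does better than the value. *)
Lemma cost_le_cost k tau x : stopping_time F tau ->
  (\int[P x]_w (cost (refined_value 0 k) b tau w)%:E <=
   \int[P x]_w (cost q (k.+1%:R * b) tau w)%:E)%E.
Proof.
move=> st.
have := @integral_grid_cost_cvg 1
  (fun n => grid_value n (k * 2 ^ n)) _ _ x
  (fun n => admissible_grid_value n (k * 2 ^ n))
  (admissible_refined_value 0 k) st (refined_value_cvg0 k).
rewrite mul1r => cv; rewrite -(cvg_lim _ cv)//.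
have cst_q y : (fun _ : nat => q y) @ \oo --> q y by exact: cvg_cst.
have cl := @integral_grid_cost_cvg k.+1
  (fun=> q) _ _ x (fun=> q_adm) q_adm st cst_q.
rewrite -(cvg_lim _ cl)//; apply: lee_lim.
- by apply/cvg_ex; eexists; exact: cv.
- by apply/cvg_ex; eexists; exact: cl.
apply: nearW => n.
have sN := @ceil_index_stopping n (k.+1 * 2 ^ n) _ st.
have kk : (1 * 2 ^ n <= k.+1 * 2 ^ n)%N by rewrite leq_mul2r orbT.
under eq_integral do rewrite (grid_cost_cap _ _ _ _ kk).
have -> : (k * 2 ^ n = k.+1 * 2 ^ n - 1 * 2 ^ n)%N by rewrite -mulnBl subn1.
rewrite [q in leRHS](_ : q = grid_value n (k.+1 * 2 ^ n - k.+1 * 2 ^ n)); last by rewrite subnn.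
by apply: grid_cost_le => //; rewrite kk leqnn.
Qed.

(** The first index at which stopping is optimal. The comparison with the grid
value is exact, so the value process is a martingale up to this index. *)
Definition optimal_index n K :=
  hit K (fun j w => expR (G (X (grid n j) w)) <= grid_value n (K - j) (X (grid n j) w)).

Lemma optimal_index_stopping n K : grid_stopping n (optimal_index n K).
Proof.
apply: hit_stopping => j jK.
apply: (@prior_state_le (grid n j) expG (grid_value n (K - j))).
- exact: grid_ge0.
- exact: admissible_expG.1.
- exact: (admissible_grid_value n (K - j)).1.
Qed.

Lemma optimal_index_before n K w j : (j < optimal_index n K w)%N ->
  grid_value n (K - j) (X (grid n j) w) < expR (G (X (grid n j) w)).
Proof. by move=> jN; have := hit_before jN; rewrite -ltNge. Qed.

Lemma optimal_index_at n K w : (optimal_index n K w < K)%N ->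
  expR (G (X (grid n (optimal_index n K w)) w)) <=
  grid_value n (K - optimal_index n K w) (X (grid n (optimal_index n K w)) w).
Proof. by move=> NK; have := hit_holds NK. Qed.

Lemma optimal_grid_cost x n K i : (i <= K)%N ->
  (\int[P x]_w (grid_cost n i (grid_value n (K - i)) (optimal_index n K) w)%:E <= (grid_value n K x)%:E)%E.
Proof.
move=> iK; rewrite -(grid_cost0 x K (optimal_index_stopping n K)).
have := @stopped_ge n K _ _
   (reward_process_ge0 n) (measurable_reward_process n) (optimal_index_stopping n K) x 0 i.
apply; first by rewrite leq0n.
- by move=> w NK; rewrite ler_wpM2l ?expR_ge0//; exact: optimal_index_at.
- by move=> w j jN _; exact: optimal_index_before.
Qed.

Lemma le_grid_value_horizon n : (forall x, q x <= grid_value n 1 x) ->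
  forall j x, grid_value n j x <= grid_value n j.+1 x.
Proof.
move=> q1; elim=> [|j IH] x; first exact: q1.
rewrite /= le_min; apply/andP; split; first by rewrite ge_min lexx.
rewrite ge_min; apply/orP; right; apply: le_continuation => //.
- exact: mesh_ge0.
- exact: admissible_grid_value.
- exact: (admissible_grid_value n j.+1).
Qed.

Lemma ge_grid_value_horizon n : (forall x, grid_value n 1 x <= q x) ->
  forall j x, grid_value n j.+1 x <= grid_value n j x.
Proof.
move=> q1; elim=> [|j IH] x; first exact: q1.
rewrite [leRHS]/= le_min; apply/andP; split; first by rewrite ge_min lexx.
rewrite ge_min; apply/orP; right; apply: le_continuation => //.
- exact: mesh_ge0.
- exact: (admissible_grid_value n j.+1).
- exact: admissible_grid_value.
Qed.

Lemma le_refined_value_horizon : (forall n x, q x <= grid_value n 1 x) ->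
  forall n i j x, (i <= j)%N -> refined_value n i x <= refined_value n j x.
Proof.
move=> q1 n i j x ij.
have ci := refined_value_cvg n i x.
have cj := refined_value_cvg n j x.
rewrite -(cvg_lim _ ci)// -(cvg_lim _ cj)//; apply: ler_lim.
- by apply/cvg_ex; eexists; exact: ci.
- by apply/cvg_ex; eexists; exact: cj.
apply: nearW => m.
have /nondecreasing_seqP mono : forall k, grid_value (n + m) k x <= grid_value (n + m) k.+1 x.
  by move=> k; exact: le_grid_value_horizon.
by apply: mono; rewrite leq_mul2r ij orbT.
Qed.

Lemma ge_refined_value_horizon : (forall n x, grid_value n 1 x <= q x) ->
  forall n i j x, (i <= j)%N -> refined_value n j x <= refined_value n i x.
Proof.
move=> q1 n i j x ij.
have ci := refined_value_cvg n i x.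
have cj := refined_value_cvg n j x.
rewrite -(cvg_lim _ ci)// -(cvg_lim _ cj)//; apply: ler_lim.
- by apply/cvg_ex; eexists; exact: cj.
- by apply/cvg_ex; eexists; exact: ci.
apply: nearW => m.
have /nonincreasing_seqP mono : forall k, grid_value (n + m) k.+1 x <= grid_value (n + m) k x.
  by move=> k; exact: ge_grid_value_horizon.
by apply: mono; rewrite leq_mul2r ij orbT.
Qed.

(** * Nearly optimal stopping on a grid *)

(** On every refinement of the grid the value process is a submartingale; let the
mesh tend to zero under the common dominating function. *)
Lemma refined_value_le_stopped n K N x : grid_stopping n N -> (forall w, (N w <= K)%N) ->
  ((refined_value n K x)%:E <=
   \int[P x]_w (discounted (grid n (N w)) (refined_value n (K - N w)) w)%:E)%E.
Proof.
move=> sN NK.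
pose J m w := discounted (grid n (N w)) (grid_value (n + m) ((K - N w) * 2 ^ m)) w.
have cl : (grid_value (n + m) (K * 2 ^ m) x)%:E @[m --> \oo] --> (refined_value n K x)%:E.
  by apply/cvg_EFin; [exact: nearW|exact: (refined_value_cvg n K x)].
have mN j : measurable [set w | N w = j].
  exact: (measurable_grid_stopping _ sN).
have mJ m : measurable_fun setT (J m).
  apply: (measurable_select (f :=
    fun j w => discounted (grid n j) (grid_value (n + m) ((K - j) * 2 ^ m)) w)) => //.
  by move=> j; apply: measurable_discounted;
    [exact: grid_ge0|exact: admissible_grid_value].
have cJ : (\int[P x]_w (J m w)%:E @[m --> \oo] -->
    \int[P x]_w (discounted (grid n (N w)) (refined_value n (K - N w)) w)%:E)%E.
  apply: (ge0_dominated_cvg (h := dominator (grid n K))) => //.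
  - move=> w _; apply: cvgM; first exact: cvg_cst.
    exact: (refined_value_cvg n (K - N w) (X (grid n (N w)) w)).
  - apply: (measurable_select (f :=
      fun j w => discounted (grid n j) (refined_value n (K - j)) w)) => //.
    by move=> j; apply: measurable_discounted;
      [exact: grid_ge0|exact: admissible_refined_value].
  - by move=> m w; apply: discounted_ge0; exact: admissible_grid_value.
  - move=> m w; apply: dominator_ge; first exact: admissible_grid_value.
    exact: le_grid.
  - exact: measurable_dominator.
  - by apply: dominator_integrable; exact: grid_ge0.
rewrite -(cvg_lim _ cl)// -(cvg_lim _ cJ)//; apply: lee_lim.
- by apply/cvg_ex; eexists; exact: cl.
- by apply/cvg_ex; eexists; exact: cJ.
apply: nearW => m; have sNm := grid_stopping_refine m sN.
pose phi j w := value_process (n + m)%N (K * 2 ^ m)%N j w.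
have phi0 j w : 0 <= phi j w.
  by apply: discounted_ge0; exact: admissible_grid_value.
have mphi j : measurable_fun setT (phi j).
  by apply: measurable_discounted;
    [exact: grid_ge0|exact: admissible_grid_value].
rewrite -(@stopped0 (n + m)%N (K * 2 ^ m)%N phi _
  phi0 mphi sNm x).
apply: (le_trans (@stopped_le (n + m)%N (K * 2 ^ m)%N
  phi _ phi0 mphi sNm x 0 (K * 2 ^ m)%N _ _)) => //; first by rewrite leqnn.
rewrite le_eqVlt; apply/orP; left; apply/eqP/eq_integral => w _; congr (_%:E).
have E1 : value_process (n + m) (K * 2 ^ m) (N w * 2 ^ m) w = J m w.
  by rewrite /J /value_process grid_refine// mulnBl.
rewrite /stopped; case: ifPn; first by rewrite /phi E1.
rewrite -leqNgt leq_pmul2r ?expn_gt0// => KN; rewrite -E1.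
by have -> : N w = K by apply/eqP; rewrite eqn_leq NK.
Qed.

Section near_optimal.
Variable eps : R.
Hypothesis eps_gt0 : 0 < eps.
Hypothesis eps_lt1 : eps < 1.

(** The threshold involves the refined value instead of the value on the grid
[n]: the condition then depends only on the current time and state and on the
remaining time, and a finer grid can only meet it earlier. *)
Definition near_index n K :=
  hit K (fun j w => (1 - eps) * expR (G (X (grid n j) w)) <= refined_value n (K - j) (X (grid n j) w)).

Lemma near_index_stopping n K : grid_stopping n (near_index n K).
Proof.
apply: hit_stopping => j jK.
apply: (@prior_state_le (grid n j) (fun x => (1 - eps) * expG x) (refined_value n (K - j))).
- exact: grid_ge0.
- by apply: measurable_funM => //; exact: admissible_expG.1.
- exact: (admissible_refined_value n (K - j)).1.
Qed.

Definition early_index n K w := minn (optimal_index n K w) (near_index n K w).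

Lemma early_index_stopping n K : grid_stopping n (early_index n K).
Proof.
apply: grid_stopping_minn; last exact: near_index_stopping.
exact: optimal_index_stopping.
Qed.

(** Up to [early_index] the grid value process is a martingale, and there the grid
value is at least [1 - eps] times the exponential of [G]. *)
Lemma early_index_cost n K x :
  ((1 - eps)%:E * \int[P x]_w (grid_cost n K q (early_index n K) w)%:E <=
   (grid_value n K x)%:E)%E.
Proof.
have e1 : 0 <= 1 - eps by rewrite subr_ge0 ltW.
pose phi j w := (1 - eps) * discounted (grid n j) expG w.
have phi0 j w : 0 <= phi j w.
  by rewrite mulr_ge0//; exact: (discounted_ge0 _ _ admissible_expG).
have mphi j : measurable_fun setT (phi j).
  apply: measurable_funM => //; apply: measurable_discounted;
    [exact: grid_ge0|exact: admissible_expG].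
have sS := early_index_stopping n K.
rewrite -(@stopped0 n K phi _ phi0 mphi sS x).
apply: (le_trans _ (@stopped_ge n K
  phi _ phi0 mphi sS x 0 K _ _ _)).
- rewrite -ge0_integralZl_EFin//; last 2 first.
  + by move=> w _; rewrite lee_fin grid_cost_ge0.
  + by apply/measurable_EFinP; exact: (measurable_grid_cost K q_adm sS).
  apply: ge0_le_integralT => w.
    by rewrite -EFinM lee_fin mulr_ge0// grid_cost_ge0.
  rewrite -EFinM lee_fin /grid_cost /stopped; case: ifP => // _.
  rewrite /value_process subnn -[leRHS]mul1r ler_wpM2r//.
    exact: (discounted_ge0 _ _ q_adm).
  by rewrite gerBl ltW.
- by rewrite leqnn.
- move=> w SK; rewrite /phi /discounted mulrCA ler_wpM2l ?expR_ge0//.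
  move: SK; rewrite /early_index.
  have [NR|RN] := leqP (optimal_index n K w) (near_index n K w).
    move=> NK.
    apply: le_trans (optimal_index_at NK); rewrite ler_piMl ?expR_ge0//.
    by rewrite gerBl ltW.
  move=> RK; apply: (le_trans (hit_holds RK)).
  have := refined_value_le_grid_value n (K - near_index n K w) (X (grid n (near_index n K w)) w) 0.
  by rewrite addn0 muln1.
- move=> w j jS _; apply: optimal_index_before; apply: leq_trans jS _; exact: geq_minl.
Qed.

Definition late_event n K := [set w | (optimal_index n K w < near_index n K w)%N].

Lemma measurable_late n K : measurable (late_event n K).
Proof.
have mN j : measurable [set w | optimal_index n K w = j].
  exact: (measurable_grid_stopping _ (optimal_index_stopping n K)).
rewrite (_ : late_event n K = \bigcup_j ([set w | optimal_index n K w = j] `&`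
    ~` [set w | (near_index n K w <= j)%N])).
  apply: bigcupT_measurable => j; apply: measurableI => //; apply: measurableC.
  by apply: (filtration_sub HF (grid_ge0 n j)); exact: near_index_stopping.
apply/seteqP; split => [w Lw|w [j _ [/= <- /negP]]]; last by rewrite /late_event /= -ltnNge.
by exists (optimal_index n K w) => //; split=> //=; apply/negP; rewrite -ltnNge.
Qed.

(** At [optimal_index] the grid value equals the exponential of [G], whereas the
refined value is below [1 - eps] times it if [near_index] comes later. The
expected gap between the two values, which is at most the gap at time [0],
therefore controls the probability of this event. *)
Lemma late_probability n K x :
  ((refined_value n K x)%:E + eps%:E * P x (late_event n K) <=
   (grid_value n K x)%:E)%E.
Proof.
set N := optimal_index n K; set L := late_event n K.
have sN : grid_stopping n N by exact: optimal_index_stopping.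
have NK w : (N w <= K)%N by exact: hit_le.
pose phi j w := value_process n K j w.
have phi0 j w : 0 <= phi j w.
  by apply: discounted_ge0; exact: admissible_grid_value.
have mphi j : measurable_fun setT (phi j).
  by apply: measurable_discounted;
    [exact: grid_ge0|exact: admissible_grid_value].
pose J w := discounted (grid n (N w)) (refined_value n (K - N w)) w.
have J0 w : 0 <= J w.
  by apply: discounted_ge0; exact: admissible_refined_value.
have mN j : measurable [set w | N w = j].
  exact: (measurable_grid_stopping _ sN).
have mJ : measurable_fun setT J.
  apply: (measurable_select (f :=
      fun j w => discounted (grid n j) (refined_value n (K - j)) w)) => //.
    by move=> j; apply: measurable_discounted;
      [exact: grid_ge0|exact: admissible_refined_value].
have mL : measurable L by exact: measurable_late.
rewrite -(@stopped0 n K phi _ phi0 mphi sN x).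
apply: (le_trans _ (@stopped_ge n K
  phi _ phi0 mphi sN x 0 K _ _ _)) => //; last 2 first.
- by rewrite leqnn.
- by move=> w j jN _; exact: optimal_index_before.
apply: (le_trans (leeD2r _ (refined_value_le_stopped x sN NK))).
rewrite [X in (_ + _ * X)%E](_ : _ = (\int[P x]_w (\1_L w)%:E)%E); last first.
  by rewrite integral_indic// setIT.
rewrite -ge0_integralZl_EFin//; last first.
- exact: ltW.
- exact/measurable_EFinP.
rewrite -ge0_integralD//; last 4 first.
- by move=> w _; rewrite lee_fin; exact: J0.
- exact/measurable_EFinP.
- by move=> w _; rewrite mule_ge0// lee_fin ltW.
- by apply: measurable_funeM; exact/measurable_EFinP.
apply: ge0_le_integralT => w.
  by apply: adde_ge0; [rewrite lee_fin; exact: J0|rewrite mule_ge0// lee_fin ltW].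
have -> : stopped n K phi N K w = value_process n K (N w) w.
  rewrite /stopped; case: ltnP => // KN.
  have NE : N w = K by apply/eqP; rewrite eqn_leq KN NK.
  by rewrite NE.
rewrite -EFinM -EFinD lee_fin /value_process /discounted.
have lv := refined_value_le_grid_value n (K - N w) (X (grid n (N w)) w) 0.
rewrite addn0 muln1 in lv.
rewrite indicE; have [/set_mem Lw|_] := boolP (w \in L); last first.
  by rewrite mulr0 addr0 ler_wpM2l ?expR_ge0.
have NK' : (N w < K)%N by apply: leq_trans Lw _; exact: hit_le.
have := hit_before Lw; rewrite -ltNge -/(N w) => lt.
have oa := optimal_index_at NK'; rewrite -/(N w) in oa.
have rc1 : 1 <= expR (rc (grid n (N w)) w).
  by rewrite -expR0 ler_expR running_cost_ge0// grid_ge0.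
have G1 : 1 <= expR (G (X (grid n (N w)) w)) by rewrite -expR0 ler_expR (reward_ge0 HS).
rewrite /= mulr1.
(* the state is where optimal_index stops and near_index has not stopped yet *)
have gap : eps <= grid_value n (K - N w) (X (grid n (N w)) w) - refined_value n (K - N w) (X (grid n (N w)) w).
  have eG : eps <= eps * expR (G (X (grid n (N w)) w)) by rewrite ler_peMr// ltW.
  by move: lt oa eG; rewrite mulrBl mul1r; lra.
set dv := grid_value _ _ _ in gap *; set dl := refined_value _ _ _ in gap *.
have dv0 : 0 <= dv - dl by apply: le_trans gap; exact: ltW.
by rewrite addrC -lerBrDr -mulrBr (le_trans gap)// ler_peMl.
Qed.

End near_optimal.
End backward_induction.

(** * Stopping without a horizon *)

Section near_optimal_time.
Variable eps : R.
Hypothesis eps_gt0 : 0 < eps.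
Hypothesis eps_lt1 : eps < 1.

Definition near_time n k := index_time n (k * 2 ^ n) (near_index one eps n (k * 2 ^ n)).

Let adm1 := admissible1.

Lemma near_time_stopping n k : stopping_time F (near_time n k).
Proof.
apply: index_time_stopping; exact: (near_index_stopping adm1).
Qed.

(** A finer grid offers more times, and a later deadline leaves more remaining
time, which raises the refined value for the terminal reward [1]. *)
Lemma near_time_decreasing n n' k k' w : (n <= n')%N -> (k <= k')%N ->
  (near_time n' k' w <= near_time n k w)%E.
Proof.
move=> nn' kk'; rewrite [leRHS]/near_time /index_time; case: ifPn => [RK|_]; last exact: leey.
set j := near_index one eps n _ w in RK *.
have E' : n' = (n + (n' - n))%N by rewrite subnKC.
have K' : (k * 2 ^ n' = k * 2 ^ n * 2 ^ (n' - n))%N by rewrite -mulnA -expnD -E'.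
have jK : (j * 2 ^ (n' - n) < k' * 2 ^ n')%N.
  apply: (@leq_trans (k * 2 ^ n')); last by rewrite leq_mul2r kk' orbT.
  by rewrite K' ltn_pmul2r// expn_gt0.
have Rj : (near_index one eps n' (k' * 2 ^ n') w <= j * 2 ^ (n' - n))%N.
  apply: hit_min; have gE : grid n' (j * 2 ^ (n' - n)) = grid n j.
    by rewrite [in LHS]E' -[in X in (_ * 2 ^ X)%N]E' grid_refine.
  rewrite gE; have /le_trans -> // := hit_holds RK.
  rewrite -(refined_value_refine adm1 n (n' - n)) -E' mulnBl -K'.
  apply: (le_refined_value_horizon adm1).
    by move=> m x; exact: (grid_value_ge1 adm1).
  by rewrite leq_sub2r// leq_mul2r kk' orbT.
rewrite /near_time /index_time (leq_ltn_trans Rj jK) lee_fin.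
rewrite (le_trans (le_grid n' Rj))//.
by rewrite [in leLHS]E' -[in X in (_ * 2 ^ X)%N]E' grid_refine.
Qed.

Section limit.
Variable n_ : nat -> nat.
Hypothesis n_nd : forall k, (n_ k <= n_ k.+1)%N.

Local Notation near k := (near_time (n_ k) k).
(** The infimum over growing horizons and meshes that are refined with them. *)
Definition limit_time w := ereal_inf (range (fun k => near k w)).
Local Notation rho := limit_time.

Lemma limit_time_stopping : stopping_time F rho.
Proof. by apply: stopping_time_inf => k; exact: near_time_stopping. Qed.

Let near_nonincreasing w : nonincreasing_seq (fun k => near k w).
Proof. by apply/nonincreasing_seqP => k; exact: near_time_decreasing. Qed.

Lemma near_time_lt n k w : (near_time n k w < +oo)%E -> (near_time n k w < (k%:R * b)%:E)%E.
Proof.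
rewrite /near_time /index_time; case: ifP => // RK _.
by rewrite lte_fin -(grid_base n k) ltr_pM2r ?mesh_gt0// ltr_nat.
Qed.

(** The times decrease to their infimum, so that right-continuity applies where the
infimum is finite; where it is infinite, all of them are. *)
Lemma near_time_cost_cvg w :
  (cost one (k%:R * b) (near k) w)%:E @[k --> \oo] --> stop_cost X G g rho w.
Proof.
have rho_le k : (rho w <= near k w)%E by apply: ereal_inf_lbound; exists k.
have [rhoy|] := eqVneq (rho w) +oo%E.
  have nE k : near k w = rho w by apply/eqP; rewrite eq_le rho_le rhoy leey.
  have -> : (fun k => (cost one (k%:R * b) (near k) w)%:E) =
      (fun k => (cost one (k%:R * b) rho w)%:E).
    by apply/funext => k; rewrite /cost nE.
  by apply: stop_cost_cvg; rewrite rhoy leey.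
rewrite -ltey => rho_lt.
have rho0 := limit_time_stopping.1 w.
have rho_fin : rho w \is a fin_num by rewrite ge0_fin_numE.
have [_ [k0 _ <-] k0y] := ereal_inf_lt rho_lt.
have near_lt k : (near (k + k0) w < +oo)%E.
  by apply: le_lt_trans k0y; apply: near_nonincreasing; exact: leq_addl.
have near_fin k : near (k + k0) w \is a fin_num.
  by rewrite ge0_fin_numE//; exact: (near_time_stopping _ _).1.
rewrite -(cvg_shiftn k0); set r := fine (rho w).
pose s k := fine (near (k + k0) w).
have sE k : (s k)%:E = near (k + k0) w by rewrite fineK.
have r0 : 0 <= r by rewrite fine_ge0.
have rs k : r <= s k by rewrite -lee_fin sE fineK.
have cs : s k @[k --> \oo] --> r.
  apply: fine_cvg; rewrite fineK//.
  rewrite (cvg_shiftn k0 (fun k => near k w)).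
  exact: (ereal_nonincreasing_cvgn (@near_nonincreasing w)).
have -> : stop_cost X G g rho w = (discounted r expG w)%:E.
  by rewrite /stop_cost -[rho w]fineK// -/r /discounted -expRD.
have -> : (fun k => (cost one ((k + k0)%:R * b) (near (k + k0)) w)%:E) =
    (fun k => (discounted (s k) expG w)%:E).
  apply/funext => k; have lt := near_time_lt (near_lt k).
  by rewrite /cost -sE in lt *; rewrite lt min_l ?ltW.
apply/cvg_EFin; first exact: nearW.
apply: (@cvg_from_right _ _ (fun u => discounted u expG w)) => //.
exact: discounted_reward_right_cvg.
Qed.

End limit.
End near_optimal_time.

(** The meshes may be refined as much as wanted, so the gaps of
[late_probability] can be made summable. *)
Lemma exists_fast_meshes (x : E) (eps : R) : 0 < eps -> exists n_ : nat -> nat,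
  (forall k, (n_ k <= n_ k.+1)%N) /\
  forall k, grid_value one (n_ k) (k * 2 ^ n_ k) x < refined_value one 0 k x + eps / (2 ^ k.+1)%:R.
Proof.
move=> eps0; have adm1 := admissible1.
have /choice[m_ Hm] : forall k, exists m, forall n, (m <= n)%N ->
    grid_value one n (k * 2 ^ n) x < refined_value one 0 k x + eps / (2 ^ k.+1)%:R.
  move=> k; have := @refined_value_cvg _ adm1 0 k x.
  move=> /cvgr_lt /(_ (refined_value one 0 k x + eps / (2 ^ k.+1)%:R)) [].
    by rewrite ltrDl divr_gt0// ltr0n expn_gt0.
  by move=> m _ Hm; exists m => n mn; exact: Hm.
exists (fun k => \sum_(i < k.+1) m_ i)%N; split=> k.
  by rewrite [leqRHS]big_ord_recr/= leq_addr.
by apply: Hm; rewrite big_ord_recr/= leq_addl.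
Qed.

(** Along the meshes of [exists_fast_meshes] the late events are summable, so by
Borel-Cantelli [early_index] and [near_index] eventually agree almost surely.
The costs at [early_index] are bounded by [early_index_cost] and converge to the
cost of the limit time; conclude by Fatou. *)
Lemma stop_cost_upper (x : E) (L eps : R) : 0 < eps < 1 ->
  (forall k, refined_value one 0 k x <= L) ->
  exists2 rho, stopping_time F rho &
    (\int[P x]_w stop_cost X G g rho w <= ((1 - eps)^-1 * (L + eps))%:E)%E.
Proof.
move=> /andP[eps0 eps1] VL; have adm1 := admissible1.
have [n_ [n_nd n_fast]] := exists_fast_meshes x eps0.
have stL := @limit_time_stopping eps n_.
pose K k := (k * 2 ^ n_ k)%N.
pose A k := late_event one eps (n_ k) (K k).
have VE k : refined_value one (n_ k) (K k) x = refined_value one 0 k x.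
  by rewrite -(refined_value_refine adm1 0 (n_ k) k) add0n.
have mA k : measurable (A k) by exact: (measurable_late adm1).
have PA k : (P x (A k) <= (1 / (2 ^ k.+1)%:R)%:E)%E.
  have := late_probability adm1 eps0 (n_ k) (K k) x.
  have Pf : P x (A k) \is a fin_num by exact: fin_num_measure.
  rewrite VE -/(A k) -(fineK Pf) -EFinM -EFinD !lee_fin => le.
  have := n_fast k; rewrite -/(K k) => lt.
  by rewrite -(ler_pM2l eps0) mulrA mulr1; move: le lt; lra.
(* almost surely only finitely many late events occur *)
pose D := ~` lim_sup_set A.
have mS : measurable (lim_sup_set A).
  by apply: bigcapT_measurable => n; apply: bigcup_measurable => j _; exact: mA.
have mD : measurable D by exact: measurableC.
have PD : P x (lim_sup_set A) = 0%E.
  apply: lim_sup_set_cvg0 => //; apply: (@le_lt_trans _ _ 1%E); last exact: ltry.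
  apply: le_trans (epsilon_trick0 xpredT ler01).
  by apply: lee_nneseries => i // _; exact: PA.
pose h k w := (grid_cost (n_ k) (K k) one (early_index one eps (n_ k) (K k)) w)%:E.
have mh k : measurable_fun setT (h k).
  apply/measurable_EFinP; apply: (measurable_grid_cost _ adm1).
  exact: (early_index_stopping adm1).
have h0 k w : (0 <= h k w)%E by rewrite lee_fin grid_cost_ge0.
set rho := limit_time eps n_.
have hD w : D w -> h k w @[k --> \oo] --> stop_cost X G g rho w.
  move=> Dw; have cw := @near_time_cost_cvg eps n_ n_nd w; apply: cvg_trans cw.
  apply: near_eq_cvg.
  have [n0 Hn0] : exists n, forall k, (n <= k)%N -> ~ A k w.
    apply: contrapT => H; apply: Dw => n _; apply: contrapT => nA.
    by apply: H; exists n => k nk Ak; apply: nA; exists k.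
  exists n0 => // k /= /Hn0 /negP; rewrite -leqNgt => RN.
  rewrite /h -(grid_base (n_ k) k) /near_time index_time_cost.
  by rewrite /grid_cost /early_index (minn_idPr RN).
have hC k : (\int[P x]_(w in D) h k w <= ((1 - eps)^-1 * (L + eps))%:E)%E.
  have e0 : 0 < 1 - eps by rewrite subr_gt0.
  apply: (@le_trans _ _ (\int[P x]_w h k w)%E).
    by rewrite integral_mkcond; apply: ge0_le_integralT => w;
      [exact: erestrict_ge0|rewrite patchE; case: ifP].
  rewrite EFinM lee_pdivlMl//.
  apply: le_trans (early_index_cost adm1 eps0 eps1 (n_ k) (K k) x) _.
  rewrite lee_fin (le_trans (ltW (n_fast k)))// lerD// ler_pdivrMr ?ltr0n ?expn_gt0//.
  by apply: ler_peMr; [exact: ltW|rewrite ler1n expn_gt0].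
exists rho => //.
have mst := measurable_stop_cost stL.
have st0 w : (0 <= stop_cost X G g rho w)%E.
  by rewrite /stop_cost; case: (rho w) => [r| |]; rewrite ?leey// lee_fin expR_ge0.
rewrite (ge0_negligible_integral mS)// setTD -/D.
rewrite (eq_integral (fun w => limn_einf (h ^~ w))); last first.
  by move=> w /set_mem Dw; rewrite (cvg_limn_einf_sup (hD w Dw)).1.
apply: le_trans (fatou _ _ _ _) _ => //.
  by move=> k; exact: measurable_funTS.
rewrite limn_einf_lim; apply: lime_le; first exact: is_cvg_einfs.
apply: nearW => k; apply: le_trans (hC k).
by apply: ereal_inf_lbound; exists k => /=.
Qed.

(** * The limits of the values over growing horizons *)

Local Notation V k := (refined_value one 0 k).
Let adm1 := admissible1.

Let V_nd x : nondecreasing_seq (fun k => V k x).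
Proof.
move=> i j ij; apply: (le_refined_value_horizon adm1) => //.
by move=> n y; exact: (grid_value_ge1 adm1).
Qed.

Let V_adm k : admissible (V k). Proof. exact: (admissible_refined_value adm1). Qed.

(** Value for long horizons with no terminal reward: an increasing limit. *)
Definition supval x := limn (fun k => V k x).

Lemma supval_cvg x : V k x @[k --> \oo] --> supval x.
Proof.
apply: nondecreasing_is_cvgn; first exact: V_nd.
by exists (expR (G x)) => _ [k _ <-]; case/andP: ((V_adm k).2 x).
Qed.

Lemma le_supval k x : V k x <= supval x.
Proof.
apply: (nondecreasing_cvgn_le (V_nd x)).
by apply/cvg_ex; eexists; exact: supval_cvg.
Qed.

Lemma supval_le x (y : \bar R) : (forall k, ((V k x)%:E <= y)%E) -> ((supval x)%:E <= y)%E.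
Proof.
move=> Vy; have cv : (V k x)%:E @[k --> \oo] --> (supval x)%:E.
  by apply/cvg_EFin; [exact: nearW|exact: supval_cvg].
rewrite -(cvg_lim _ cv)//; apply: lime_le; first by apply/cvg_ex; eexists; exact: cv.
exact: nearW.
Qed.

Lemma admissible_supval : admissible supval.
Proof.
split.
  apply: (@measurable_fun_cvg _ (borel E) _ _ (fun k => V k)).
    by move=> k; exact: (V_adm k).1.
  by move=> x _; exact: supval_cvg.
move=> x; apply/andP; split.
  by apply: le_trans (le_supval 0 x); case/andP: ((V_adm 0).2 x).
by rewrite -lee_fin; apply: supval_le => k; rewrite lee_fin; case/andP: ((V_adm k).2 x).
Qed.

Lemma supval_le_cost tau x : stopping_time F tau ->
  ((supval x)%:E <= \int[P x]_w (cost supval b tau w)%:E)%E.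
Proof.
move=> st; apply: supval_le => k.
apply: (@le_trans _ _ (V k.+1 x)%:E); first by rewrite lee_fin; exact: V_nd.
apply: (le_trans (refined_value_le_cost adm1 k x st)).
by apply: integral_cost_le => // y; exact: le_supval.
Qed.

Lemma cost_supval_le_stop_cost tau x : stopping_time F tau ->
  (\int[P x]_w (cost supval b tau w)%:E <= \int[P x]_w stop_cost X G g tau w)%E.
Proof.
move=> st; have cv := @integral_cost_cvg (fun k => V k) supval tau x V_adm admissible_supval st (@supval_cvg).
rewrite -(cvg_lim _ cv)//; apply: lime_le; first by apply/cvg_ex; eexists; exact: cv.
apply: nearW => k; apply: (le_trans (cost_le_cost adm1 k x st)).
apply: ge0_le_integralT => w; first by rewrite lee_fin cost_ge0.
apply: cost_le_stop_cost; last exact: st.1.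
by rewrite mulr_ge0// ltW.
Qed.

(** The lower bound holds for each deadline; the attainability of the limit is
[stop_cost_upper]. *)
Lemma inf_stop_cost x :
  ereal_inf [set (\int[P x]_w stop_cost X G g tau w)%E | tau in stopping_time F] =
  (supval x)%:E.
Proof.
apply/eqP; rewrite eq_le; apply/andP; split; last first.
  apply: le_ereal_inf_tmp => _ [tau st <-].
  exact: le_trans (supval_le_cost x st) (cost_supval_le_stop_cost x st).
(* tolerances in ]0, 1[ that tend to 0 *)
pose e n : R := n.+2%:R^-1.
have e01 n : 0 < e n < 1 by rewrite invr_gt0 ltr0n/= invf_lt1 ?ltr0n// ltr1n.
have ce : e n @[n --> \oo] --> (0 : R).
  have -> : e = (fun n => harmonic (n + 1)%N) by apply/funext => n; rewrite addn1.
  by rewrite (cvg_shiftn 1 (@harmonic R)); exact: cvg_harmonic.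
have cv : ((1 - e n)^-1 * (supval x + e n))%:E @[n --> \oo] --> (supval x)%:E.
  apply/cvg_EFin; first exact: nearW.
  rewrite -[X in _ --> X]mul1r -[X in X * _]invr1; apply: cvgM.
    apply: cvgV; first exact: oner_neq0.
    by rewrite -[X in _ --> X]subr0; apply: cvgB => //; exact: cvg_cst.
  by rewrite -[X in _ --> X]addr0; apply: cvgD => //; exact: cvg_cst.
rewrite -(cvg_lim _ cv)//; apply: lime_ge; first by apply/cvg_ex; eexists; exact: cv.
apply: nearW => n.
have [rho st le] := stop_cost_upper (e01 n) (fun k => le_supval k x).
by apply: le_trans le; apply: ereal_inf_lbound; exists rho.
Qed.

Local Notation W k := (refined_value expG 0 k).
Let admG := admissible_expG.

Let W_ni x : nonincreasing_seq (fun k => W k x).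
Proof.
move=> i j ij; apply: (ge_refined_value_horizon admG) => //.
by move=> n y; exact: (grid_value_le admG).
Qed.

Let W_adm k : admissible (W k). Proof. exact: (admissible_refined_value admG). Qed.

(** Value for long horizons with the exponential of [G] as terminal reward: a
decreasing limit, since a later deadline allows more strategies. *)
Definition infval x := limn (fun k => W k x).

Lemma infval_cvg x : W k x @[k --> \oo] --> infval x.
Proof.
apply: nonincreasing_is_cvgn; first exact: W_ni.
by exists 1 => _ [k _ <-]; case/andP: ((W_adm k).2 x).
Qed.

Lemma infval_le k x : infval x <= W k x.
Proof.
apply: (nonincreasing_cvgn_ge (W_ni x)).
by apply/cvg_ex; eexists; exact: infval_cvg.
Qed.

(** [infval] is the infimum of the grid values over all meshes and horizons. At
least one unit of time remains, which [inf_cost_infval] uses. *)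
Lemma le_infval x (y : \bar R) :
  (forall n k, (y <= (grid_value expG n (k.+1 * 2 ^ n) x)%:E)%E) -> (y <= (infval x)%:E)%E.
Proof.
move=> yW.
have yWk k : (y <= (W k.+1 x)%:E)%E.
  have cl : (grid_value expG n (k.+1 * 2 ^ n) x)%:E @[n --> \oo] --> (W k.+1 x)%:E.
    by apply/cvg_EFin; [exact: nearW|exact: (@refined_value_cvg _ admG 0 k.+1 x)].
  rewrite -(cvg_lim _ cl)//; apply: lime_ge; first by apply/cvg_ex; eexists; exact: cl.
  exact: nearW.
have cv : (W k x)%:E @[k --> \oo] --> (infval x)%:E.
  by apply/cvg_EFin; [exact: nearW|exact: infval_cvg].
rewrite -(cvg_lim _ cv)//; apply: lime_ge; first by apply/cvg_ex; eexists; exact: cv.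
by exists 1%N => // -[].
Qed.

Lemma infval_le_grid_value n k x : infval x <= grid_value expG n (k * 2 ^ n) x.
Proof. exact: le_trans (infval_le k x) (refined_value_le_grid_value admG 0 k x n). Qed.

Lemma admissible_infval : admissible infval.
Proof.
split.
  apply: (@measurable_fun_cvg _ (borel E) _ _ (fun k => W k)).
    by move=> k; exact: (W_adm k).1.
  by move=> x _; exact: infval_cvg.
move=> x; apply/andP; split; last first.
  by apply: le_trans (infval_le 0 x) _; case/andP: ((W_adm 0).2 x).
rewrite -lee_fin; apply: le_infval => n k; rewrite lee_fin.
exact: (grid_value_ge1 admG).
Qed.

Lemma infval_le_cost tau x : stopping_time F tau ->
  ((infval x)%:E <= \int[P x]_w (cost infval b tau w)%:E)%E.
Proof.
move=> st; have cv := @integral_cost_cvg (fun k => W k) infval tau x W_adm admissible_infval st (@infval_cvg).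
rewrite -(cvg_lim _ cv)//; apply: lime_ge; first by apply/cvg_ex; eexists; exact: cv.
apply: nearW => k; apply: (le_trans _ (refined_value_le_cost admG k x st)).
by rewrite lee_fin infval_le.
Qed.

Definition optimal_time n K := index_time n K (optimal_index expG n K).

Lemma optimal_time_stopping n K : stopping_time F (optimal_time n K).
Proof. apply: index_time_stopping; exact: (optimal_index_stopping admG). Qed.

Lemma optimal_time_cost n K x :
  (\int[P x]_w (cost expG (grid n K) (optimal_time n K) w)%:E <= (grid_value expG n K x)%:E)%E.
Proof.
under eq_integral do rewrite index_time_cost.
have := optimal_grid_cost admG x n (leqnn K).
by rewrite subnn.
Qed.

Lemma inf_cost_infval x :
  (ereal_inf [set \int[P x]_w (cost infval b tau w)%:E | tau in stopping_time F] <=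
   (infval x)%:E)%E.
Proof.
apply: le_infval => n k.
have kk : (1 * 2 ^ n <= k.+1 * 2 ^ n)%N by rewrite leq_mul2r orbT.
apply: le_trans (optimal_grid_cost admG x n kk).
rewrite -mulnBl subn1/=.
have sN := optimal_index_stopping admG n (k.+1 * 2 ^ n).
have st := index_time_stopping (1 * 2 ^ n) sN.
apply: (@le_trans _ _ (\int[P x]_w (cost infval b
  (index_time n (1 * 2 ^ n) (optimal_index expG n (k.+1 * 2 ^ n))) w)%:E)%E).
  by apply: ereal_inf_lbound; eexists; first exact: st.
under [leRHS]eq_integral do rewrite -(index_time_cost) grid_base mul1r.
apply: integral_cost_le; first exact: admissible_infval.
by move=> y; exact: infval_le_grid_value.
Qed.

(** Before a deadline that exceeds [T], stopping at the minimum of [tau] and [T]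
costs the same with and without the deadline. *)
Lemma infval_le_stop_cost tau T x : stopping_time F tau -> 0 <= T ->
  ((infval x)%:E <= \int[P x]_w stop_cost X G g (fun w => mine (tau w) T%:E) w)%E.
Proof.
move=> st T0; have stT := stopping_time_min st T0.
have [k Tk] : exists k, T < k.+1%:R * b.
  exists (Num.bound (T / b)); rewrite -ltr_pdivrMr//.
  apply: lt_le_trans (archi_boundP _) _; first by rewrite divr_ge0// ltW.
  by rewrite ler_nat.
apply: (@le_trans _ _ (\int[P x]_w (cost expG (k.+1%:R * b) (fun w => mine (tau w) T%:E) w)%:E)%E); last first.
  rewrite le_eqVlt; apply/orP; left; apply/eqP/eq_integral => w _.
  have : (0 <= mine (tau w) T%:E <= T%:E)%E by rewrite stT.1 ge_min lexx orbT.
  rewrite /cost /stop_cost; case: (mine (tau w) T%:E) => [r| |]//= /andP[r0 rT].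
    have rk : r < k.+1%:R * b by apply: le_lt_trans Tk; rewrite -lee_fin.
    by rewrite lte_fin rk min_l ?lee_fin ?ltW//= expRD.
  by move: rT; rewrite leye_eq.
apply: (le_trans _ (cost_le_cost admG k x stT)).
apply: (le_trans _ (refined_value_le_cost admG k x stT)).
by rewrite lee_fin infval_le.
Qed.

End grid.

(** * The Bellman equation *)

Local Notation log p := (fun x => (ln (p x))%:E).

Lemma admissible_gt0 (p : E -> R) x : admissible p -> 0 < p x.
Proof. by move=> [_ /(_ x)/andP[p1 _]]; exact: lt_le_trans p1. Qed.

Lemma bellman_costE p t tau w : admissible p ->
  bellman_cost X G g (log p) t tau w = (cost p t tau w)%:E.
Proof.
move=> ap; rewrite /bellman_cost /cost /=; case: ifP => _; rewrite -EFinD/= expRD//.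
by rewrite lnK// posrE admissible_gt0.
Qed.

(** At [t = 0] no stopping occurs before the deadline and the cost is [p (X 0)];
only positive [t] carry information. *)
Lemma bellman_solution_log p : admissible p ->
  (forall t x, 0 < t -> (p x)%:E =
     ereal_inf [set (\int[P x]_w (cost p t tau w)%:E)%E | tau in stopping_time F]) ->
  bellman_solution F X P G g (log p).
Proof.
move=> ap eqp; split.
- by apply/measurable_EFinP; apply: measurableT_comp => //; exact: ap.1.
- move=> x; rewrite ltry andbT lee_fin ln_ge0//.
  by case/andP: (ap.2 x).
move=> t x t0; rewrite /= lnK ?posrE ?admissible_gt0//.
have -> : [set (\int[P x]_w bellman_cost X G g (log p) t tau w)%E | tau in stopping_time F] =
    [set (\int[P x]_w (cost p t tau w)%:E)%E | tau in stopping_time F].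
  by apply: eq_imagel => tau _; apply: eq_integral => w _; exact: bellman_costE.
have [t_gt0|] := ltP 0 t; first exact: eqp.
move=> tle0; have -> : t = 0 by apply/eqP; rewrite eq_le tle0.
have c0 tau : stopping_time F tau -> (\int[P x]_w (cost p 0 tau w)%:E = (p x)%:E)%E.
  move=> st; apply: integral_start.
  - by move=> w; rewrite lee_fin cost_ge0.
  - by rewrite lee_fin ltW// admissible_gt0.
  - by apply/measurable_EFinP; rewrite -(mul0r (1 : R)); exact: (measurable_cost ltr01 0 ap st).
  move=> w X0; rewrite /cost /= ltNge (st.1 w)/=.
  have -> : Order.min (tau w) 0%:E = 0%:E by apply/min_idPr; exact: st.1.
  by rewrite /= running_cost0 expR0 mul1r X0.
apply/eqP; rewrite eq_le; apply/andP; split.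
  by apply: le_ereal_inf_tmp => _ [tau st <-]; rewrite c0.
apply: ereal_inf_lbound; exists (cst 0%:E); last by rewrite c0//; exact: stopping_time_cst.
exact: stopping_time_cst.
Qed.

Lemma value_uE b : 0 < b -> value_u F X P G g = log (supval b).
Proof.
move=> b0; apply/funext => x; have as_ := admissible_supval b0.
rewrite /value_u -(@ereal_inf_lne _
   [set (\int[P x]_w stop_cost X G g tau w)%E | tau in stopping_time F]).
- by rewrite image_comp.
- exact: admissible_gt0.
- move=> _ [tau st <-].
  exact: le_trans (supval_le_cost b0 x st) (cost_supval_le_stop_cost b0 x st).
- by rewrite (inf_stop_cost b0).
Qed.

(** The time unit is arbitrary, which lets every [t > 0] play the role of [b] in
the Bellman equation. *)
Lemma supval_base b b' : 0 < b -> 0 < b' -> supval b = supval b'.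
Proof.
move=> b0 b'0; apply/funext => x; apply: EFin_inj.
exact: etrans (esym (inf_stop_cost b0 x)) (inf_stop_cost b'0 x).
Qed.

(** For a given [tau] every stopping time truncated at [T] costs at least
[infval]; conversely the optimal grid strategies are bounded, so that their
truncations are eventually constant in [T]. *)
Lemma value_wE b : 0 < b -> value_w F X P G g = log (infval b).
Proof.
move=> b0; apply/funext => x; have ai := admissible_infval b0.
have lK y : (0 <= y)%E -> expeR (lne y) = y by move=> y0; apply/eqP; rewrite lneK_eq.
apply/eqP; rewrite eq_le; apply/andP; split; last first.
  apply: le_ereal_inf_tmp => _ [tau st <-]; rewrite limf_einfE.
  apply: (@le_trans _ _ (ereal_inf ((fun T : R => lne (\int[P x]_w
      stop_cost X G g (fun w => mine (tau w) T%:E) w)%E) @` [set T | 0 <= T]))); last first.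
    apply: ereal_sup_ubound; exists [set T | 0 <= T] => //.
    by exists 0; split => // y /ltW.
  apply: le_ereal_inf_tmp => _ [T /= T0 <-].
  have le := infval_le_stop_cost b0 x st T0.
  rewrite -lee_expeR lK; last by apply: le_trans le; rewrite lee_fin ltW// admissible_gt0.
  by rewrite /= lnK// posrE admissible_gt0.
rewrite -lee_expeR [leRHS]/= lnK ?posrE ?admissible_gt0//.
apply: (le_infval b0) => n k; set K := (k.+1 * 2 ^ n)%N.
pose tau w := mine (optimal_time b n K w) (grid b n K)%:E.
have gK0 := grid_ge0 b0 n K.
have st : stopping_time F tau.
  by apply: stopping_time_min => //; exact: (optimal_time_stopping b0).
rewrite -[leRHS]lK; last first.
  by rewrite lee_fin (le_trans _ (grid_value_ge1 b0 admissible_expG _ _ _)).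
rewrite lee_expeR.
(* past its last grid point, truncation at T changes nothing *)
have cE w T : grid b n K <= T ->
   stop_cost X G g (fun w => mine (tau w) T%:E) w =
   (cost expG (grid b n K) (optimal_time b n K) w)%:E.
  move=> KT; rewrite /stop_cost /cost /tau /=.
  set r := optimal_time _ _ _ _; have : (r = +oo%E) \/ exists2 s, s < grid b n K & r = s%:E.
    rewrite /r /optimal_time /index_time; case: ltnP => NK; last by left.
    by right; eexists; last reflexivity; rewrite ltr_pM2r ?mesh_gt0// ltr_nat.
  move=> [->|[s sK ->]].
    rewrite ltNge leey/= !(min_r (leey _)) min_l ?lee_fin//=.
    by rewrite expRD.
  rewrite lte_fin sK !min_l ?lee_fin ?(ltW sK)//; last by rewrite (le_trans (ltW sK)).
  by rewrite /= expRD.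
apply: (@le_trans _ _ (lne (\int[P x]_w (cost expG (grid b n K) (optimal_time b n K) w)%:E)%E)).
  apply: (@le_trans _ _ (limf_einf (fun T : R => lne (\int[P x]_w stop_cost X G g (fun w => mine (tau w) T%:E) w)%E) +oo%R)).
    by apply: ereal_inf_lbound; exists tau.
  rewrite limf_einfE; apply: ub_ereal_sup => _ [V [y [_ yV]] <-].
  pose T := Num.max (y + 1) (grid b n K).
  apply: ereal_inf_lbound; exists T.
    by apply: yV; rewrite lt_max ltrDl ltr01.
  congr lne; apply: eq_integral => w _; apply: cE.
  by rewrite le_max lexx orbT.
have le := optimal_time_cost b0 n K x.
rewrite lee_lne// in_itv/= ?leey ?andbT.
  by apply: integral_ge0 => w _; rewrite lee_fin (cost_ge0 _ _ _ admissible_expG).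
by rewrite lee_fin (le_trans _ (grid_value_ge1 b0 admissible_expG _ _ _)).
Qed.

Lemma value_u_bellman : bellman_solution F X P G g (value_u F X P G g).
Proof.
rewrite (value_uE ltr01); apply: bellman_solution_log.
  exact: (admissible_supval ltr01).
move=> t x t0; rewrite (supval_base ltr01 t0).
apply/eqP; rewrite eq_le; apply/andP; split.
  by apply: le_ereal_inf_tmp => _ [tau st <-]; exact: (supval_le_cost t0).
rewrite -(inf_stop_cost t0); apply: le_ereal_inf_tmp => _ [tau st <-].
apply: le_trans (cost_supval_le_stop_cost t0 x st).
by apply: ereal_inf_lbound; exists tau.
Qed.

Lemma value_w_bellman : bellman_solution F X P G g (value_w F X P G g).
Proof.
have base t : 0 < t -> infval 1 = infval t.
  move=> t0; apply/funext => x.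
  have lnE : ln (infval 1 x) = ln (infval t x).
    apply: EFin_inj; exact: (congr1 (fun f => f x) (etrans (esym (value_wE ltr01)) (value_wE t0))).
  apply: ln_inj lnE; rewrite posrE admissible_gt0//;
    [exact: (admissible_infval ltr01)|exact: (admissible_infval t0)].
rewrite (value_wE ltr01); apply: bellman_solution_log.
  exact: (admissible_infval ltr01).
move=> t x t0; rewrite (base t t0).
apply/eqP; rewrite eq_le (inf_cost_infval t0) andbT.
by apply: le_ereal_inf_tmp => _ [tau st <-]; exact: (infval_le_cost t0).
Qed.

(** The exponential of [v] lies between [1] and that of [G]; at the deadlines
[k.+1] the Bellman equation of [v] is thus squeezed between the problems with
these two terminal rewards, whose values tend to those of [u] and [w]. *)
Lemma bellman_solution_between (v : E -> \bar R) :
  bellman_solution F X P G g v -> (forall x, (0 <= v x <= (G x)%:E)%E) ->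
  forall x, (value_u F X P G g x <= v x <= value_w F X P G g x)%E.
Proof.
move=> [mv rv eqv] vG x.
pose p y := expR (fine (v y)).
have vfin y : v y \is a fin_num by case/andP: (rv y) => v0 vy; rewrite ge0_fin_numE.
have ap : admissible p.
  split.
    apply: measurableT_comp => //; apply: measurableT_comp => //.
  move=> y; case/andP: (vG y) => v0 vGy; rewrite -{1}expR0 !ler_expR.
  by rewrite fine_ge0//= -lee_fin fineK.
have vE : v = log p by apply/funext => y; rewrite /p expRK fineK.
have eqp (k : nat) y : (p y)%:E =
    ereal_inf [set (\int[P y]_w (cost p (k%:R) tau w)%:E)%E | tau in stopping_time F].
  transitivity (expeR (v y)); first by rewrite -[v y]fineK.
  rewrite (eqv k%:R y)//; congr ereal_inf; apply: eq_imagel => tau _; apply: eq_integral => w _.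
  by rewrite vE bellman_costE.
rewrite (value_uE ltr01) (value_wE ltr01) vE !lee_fin.
have sup_gt0 := admissible_gt0 x (admissible_supval ltr01).
have inf_gt0 := admissible_gt0 x (admissible_infval ltr01).
have p_gt0 := admissible_gt0 x ap.
rewrite !ler_ln ?posrE//.
apply/andP; split; rewrite -lee_fin.
  apply: (supval_le ltr01) => k; have adm1 := admissible1.
  apply: (@le_trans _ _ (refined_value 1 one 0 k.+1 x)%:E).
    rewrite lee_fin; apply: (le_refined_value_horizon ltr01 adm1) => //.
    by move=> n y; exact: (grid_value_ge1 ltr01 adm1).
  rewrite (eqp k.+1); apply: le_ereal_inf_tmp => _ [tau st <-].
  apply: (le_trans (refined_value_le_cost ltr01 adm1 k x st)).
  apply: (le_trans (cost_le_cost ltr01 adm1 k x st)); rewrite mulr1.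
  by apply: integral_cost_le => // y; case/andP: (ap.2 y).
apply: (le_infval ltr01) => n k.
apply: (le_trans _ (optimal_time_cost ltr01 n _ x)).
rewrite (eqp k.+1) grid_base mulr1.
apply: (@le_trans _ _ (\int[P x]_w (cost p k.+1%:R
    (optimal_time 1 n (k.+1 * 2 ^ n)) w)%:E)%E).
  apply: ereal_inf_lbound; exists (optimal_time 1 n (k.+1 * 2 ^ n)) => //.
  exact: (optimal_time_stopping ltr01).
by apply: integral_cost_le => // y; case/andP: (ap.2 y).
Qed.

End optimal_stopping.

Theorem theorem5p2 (R : realType) (E : pmetricType R) (d : measure_display)
    (Omega : measurableType d) (F : R -> set (set Omega))
    (X : R -> Omega -> E) (P : E -> probability Omega R) (G g : E -> R)
    (E_lc : locally_compact [set: E]) (E_sep : separable E)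
    (X_std : standard_markov_process F X P) (X_feller : C0_feller X P)
    (G_ge0 : forall x, (0 <= G x)%R) (G_cont : continuous G)
    (g_cont : continuous g)
    (g_bounded : exists M : R, forall x, (g x <= M)%R)
    (g_lower : exists2 c : R, (0 < c)%R & forall x, (c <= g x)%R)
    (G_sup : forall (T : R) (x : E), (0 <= T)%R ->
      \int[P x]_w
        ereal_sup [set (expR (G (X t w)))%:E | t in `[0%R, T]%classic] < +oo)
    (h_cont : forall (T : R) (h : E -> R), (0 <= T)%R ->
      continuous h -> (forall x, (0 <= h x <= G x)%R) ->
      continuous (fun x : E =>
        \int[P x]_w (expR (running_cost X g T w + h (X T w)))%:E)) :
  (bellman_solution F X P G g (value_u F X P G g) /\
   bellman_solution F X P G g (value_w F X P G g)) /\
  (forall v : E -> \bar R, bellman_solution F X P G g v ->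
    (forall x, 0 <= v x <= (G x)%:E) ->
    forall x, value_u F X P G g x <= v x <= value_w F X P G g x).
Proof.
have [M gM] := g_bounded; have [c c0 gc] := g_lower.
have HS : stopping_problem F X P G g c M by split.
split; first by split; [exact: (value_u_bellman HS)|exact: (value_w_bellman HS)].
by move=> v; exact: (bellman_solution_between HS).
Qed.
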